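(* Let $G$ be an obstruction for the class $\mathcal C$ of all graphs of linear rankwidth at most $1$. Then one of the following holds: (1) $G$ is isomorphic to the net graph $N$; (2) $G$ is $2$-connected; (3) $G$ has a $2$-connected subgraph $G_0\subseteq G$ and a vertex $u\in V(G)$ such that $V(G)=V(G_0)\cup\{u\}$ and $u$ is a pendant vertex of $G$; (4) $G$ contains a $2$-connected subgraph $G_0\subseteq G$ and two vertices $u,v\in V(G)$ such that $V(G)=V(G_0)\cup\{u,v\}$, $u$ and $v$ are pendant vertices of $G$, and $N_G(u)\cap N_G(v)=\emptyset$.
   Context: Graphs are finite, simple, undirected; a pendant vertex is a vertex of degree $1$; a graph is $2$-connected if it has at least $2$ vertices and cannot be disconnected by removing fewer than $2$ vertices. For $X\subseteq V(G)$, $\operatorname{cutrk}_G(X)$ is the $\mathrm{GF}(2)$-rank of the submatrix of the adjacency matrix with rows $X$ and columns $V(G)\setminus X$. A linear rank decomposition of $G$ ($|V(G)|\ge2$) is a pair $(T,\lambda)$ with $T$ a caterpillar with at least two vertices whose non-leaf vertices have degree $3$ and $\lambda$ a bijection from leaves of $T$ to $V(G)$; an edge $e$ of $T$ splitting the leaves into $(X_e,Y_e)$ has width $\operatorname{cutrk}_G(\lambda(X_e))$; linear rankwidth is the minimum over decompositions of the maximum edge width ($0$ if $|V(G)|\le1$). The local complementation $G*v$ has vertex set $V(G)$ and edge set $E(G)$ symmetric-differenced with all pairs of distinct vertices of $N_G(v)$; $G$ and $H$ are locally equivalent if $H$ arises from $G$ by a sequence of local complementations. A graph $G$ is an obstruction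 for $\mathcal C$ if every $H$ locally equivalent to $G$ satisfies $H\notin\mathcal C$ and $H\setminus v\in\mathcal C$ for every $v\in V(H)$. The net graph $N$ is a triangle $x_1x_2x_3$ plus vertices $y_1,y_2,y_3$ with $y_i$ adjacent only to $x_i$. *)

(* Defs.v *)
From mathcomp Require Import all_boot all_order all_algebra.

Set Implicit Arguments.
Unset Strict Implicit.
Unset Printing Implicit Defensive.

Record sgraph (V : finType) := SGraph {
  adj :> rel V;
  adj_sym : symmetric adj;
  adj_irr : irreflexive adj }.

Section Basics.
Variables (V : finType) (G : sgraph V).

Definition nbr (x : V) : {set V} := [set y | G x y].

Definition degree (x : V) : nat := #|nbr x|.

Definition pendant (x : V) : bool := degree x == 1.

Definition connected : Prop := 0 < #|V| /\ forall x y, connect G x y.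

Definition is_tree : Prop :=
  connected /\ forall c : seq V, 2 < size c -> ~ ucycle G c.

Definition is_caterpillar : Prop :=
  is_tree /\
  exists (x : V) (p : seq V), [/\ path G x p, uniq (x :: p) &
    forall y, y \notin x :: p -> exists2 z, z \in x :: p & G y z].

Section Delete.
Variable S : {set V}.

Definition del_adj : rel {x : V | x \notin S} := relpre val G.

Lemma del_adj_sym : symmetric del_adj.
Proof. by move=> x y; apply: adj_sym. Qed.

Lemma del_adj_irr : irreflexive del_adj.
Proof. by move=> x; apply: adj_irr. Qed.

Definition delete : sgraph {x : V | x \notin S} :=
  SGraph del_adj_sym del_adj_irr.

End Delete.

Section LocalComplement.
Variable v : V.

Definition lc_adj : rel V :=
  fun x y => G x y (+) [&& x != y, x \in nbr v & y \in nbr v].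

Lemma lc_adj_sym : symmetric lc_adj.
Proof.
move=> x y; rewrite /lc_adj (adj_sym G x y) eq_sym.
by rewrite [(x \in _) && _]andbC.
Qed.

Lemma lc_adj_irr : irreflexive lc_adj.
Proof. by move=> x; rewrite /lc_adj adj_irr eqxx. Qed.

Definition local_complement : sgraph V := SGraph lc_adj_sym lc_adj_irr.

End LocalComplement.

Definition cutrk (X : {set V}) : nat :=
  \rank (\matrix_(i < #|X|, j < #|~: X|)
           ((G (enum_val i) (enum_val j))%:R : 'F_2))%R.

End Basics.

Definition two_connected (V : finType) (G : sgraph V) : Prop :=
  2 <= #|V| /\ forall S : {set V}, #|S| < 2 -> connected (delete G S).

Definition locally_equivalent (V : finType) (G H : sgraph V) : Prop :=
  exists s : seq V, H =2 foldl (@local_complement V) G s.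

Definition isomorphic (V W : finType) (G : sgraph V) (H : sgraph W) : Prop :=
  exists2 f : V -> W, bijective f & forall x y, H (f x) (f y) = G x y.

(* A subgraph need not be induced. *)
Definition subgraph (V : finType) (S : {set V})
    (G0 : sgraph {x : V | x \in S}) (G : sgraph V) : Prop :=
  forall x y, G0 x y -> G (val x) (val y).

Record lin_rank_dec (V : finType) := LinRankDec {
  lrd_node : finType;
  lrd_tree : sgraph lrd_node;
  lrd_label : {x : lrd_node | pendant lrd_tree x} -> V;
  lrd_caterpillar : is_caterpillar lrd_tree;
  lrd_size : 2 <= #|lrd_node|;
  lrd_cubic : forall x, ~~ pendant lrd_tree x -> degree lrd_tree x = 3;
  lrd_label_bij : bijective lrd_label }.

Section Width.
Variables (V : finType) (G : sgraph V) (D : lin_rank_dec V).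

Definition edge_deleted (a b : lrd_node D) : rel (lrd_node D) :=
  fun x y => lrd_tree D x y && ([set x; y] != [set a; b]).

(* Labels of the leaves on the side of [a] once the edge [ab] is removed. *)
Definition edge_side (a b : lrd_node D) : {set V} :=
  [set lrd_label l | l : {x | pendant (lrd_tree D) x} &
                     connect (edge_deleted a b) a (val l)].

(* Each edge is met in both orientations, giving both sides of its cut;
   these have the same cut-rank. *)
Definition lrd_width : nat :=
  \max_(ab : lrd_node D * lrd_node D | lrd_tree D ab.1 ab.2)
    cutrk G (edge_side ab.1 ab.2).

End Width.

(* [linear_rankwidth G k]: the linear rankwidth of [G] is [k]. *)
Definition linear_rankwidth (V : finType) (G : sgraph V) (k : nat) : Prop :=
  if #|V| <= 1 then k = 0
  else (exists D : lin_rank_dec V, lrd_width G D = k) /\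
       (forall D : lin_rank_dec V, k <= lrd_width G D).

Definition graph_class := forall V : finType, sgraph V -> Prop.

Definition linear_rankwidth_le1 : graph_class :=
  fun V G => exists2 k, linear_rankwidth G k & k <= 1.

Definition obstruction (C : graph_class) (V : finType) (G : sgraph V) : Prop :=
  forall H : sgraph V, locally_equivalent G H ->
    ~ C V H /\ forall v : V, C _ (delete H [set v]).

(* [inl i] is the triangle vertex x_i and [inr i] its pendant neighbour y_i. *)
Definition net_adj : rel ('I_3 + 'I_3)%type := fun x y =>
  match x, y with
  | inl i, inl j => i != j
  | inl i, inr j | inr i, inl j => i == j
  | inr _, inr _ => false
  end.

Lemma net_adj_sym : symmetric net_adj.
Proof. by move=> [i|i] [j|j] //=; rewrite eq_sym. Qed.

Lemma net_adj_irr : irreflexive net_adj.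
Proof. by move=> [i|i] //=; rewrite eqxx. Qed.

Definition net : sgraph ('I_3 + 'I_3)%type := SGraph net_adj_sym net_adj_irr.

(* Main.v *)
Require Import Defs.
From mathcomp Require Import all_boot all_order all_algebra.
From mathcomp Require Import zify.

(* Linear rankwidth at most 1 means that the vertices have a layout, a linear order all of
   whose initial segments have cut-rank at most 1.  An obstruction G has no layout, while
   H - v has one for every H locally equivalent to G.

   In a layout, a vertex v carrying a pendant vertex has no edge passing over it.  Hence
   two pendant vertices cannot share their neighbour, and if G - v splits into two sides
   with at least two vertices each, every side is a union of at most two parts admitting a
   layout that ends at v.  Parts consisting of a pendant vertex aside, two parts would give
   a layout of G, and three parts contain a subdivided claw or a variant of it whose centre
   v can be removed after complementing at v, leaving a graph without layout.  So removing
   the pendant vertices leaves a 2-connected core.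

   Suppose that there are three pendant vertices y_i, with neighbours x_i.  In a layout of
   G - y_3 the vertices x_1 and x_2 are the two ends of the core, and the vertex of the core
   next to an end is a twin of it.  If the core is larger than {x_1, x_2, x_3}, this gives
   some x_i (say x_1) a twin t in the core outside {x_1, x_2, x_3}.  Then G - t has no layout
   if x_2 and x_3 are connected in the core without x_1 and t; otherwise G*t - t or
   G*x_1*t - t has none, according to whether t and x_1 are non-adjacent or adjacent.  Thus
   the core is a triangle and G is the net. *)

Set Implicit Arguments.
Unset Strict Implicit.
Unset Printing Implicit Defensive.

(** * Cuts of rank at most one *)

Section RankOne.
Import GRing.Theory.
Local Open Scope ring_scope.

(** A matrix of rank at most 1 factors as a column times a row, so its 2x2 minors vanish. Conversely
    a nonzero entry [A i0 j0] exhibits [A] as its rescaled column [j0] times its row [i0]. *)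
Lemma mxrank_le1P (F : fieldType) m n (A : 'M[F]_(m, n)) :
  reflect (forall i i' j j', A i j * A i' j' = A i j' * A i' j)
          (\rank A <= 1)%N.
Proof.
apply: (iffP idP) => [|minorA].
  move=> rA i i' j j'; rewrite -(mulmx_base A) !mxE.
  case: (\rank A) rA (col_base A) (row_base A) => [|[|//]] _ C B.
    by rewrite !big_ord0.
  by rewrite !big_ord1 mulrACA [X in _ * X]mulrC mulrACA.
have [->|nzA] := eqVneq A 0; first by rewrite mxrank0.
have [i0 /existsP [j0 nz0]] : exists i, [exists j, A i j != 0].
  apply/existsP; apply: contra_neqT nzA => /existsPn A0.
  by apply/matrixP => i j; have /existsPn/(_ j) := A0 i; rewrite negbK mxE => /eqP.
have -> : A = (\matrix_(i < m, k < 1) (A i j0 / A i0 j0)) *m row i0 A.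
  apply/matrixP => i j; rewrite !mxE big_ord1 !mxE mulrAC minorA mulfK //.
by rewrite (leq_trans (mxrankM_maxl _ _)) // rank_leq_col.
Qed.

Lemma cutrk_le1P (V : finType) (G : sgraph V) (X : {set V}) :
  reflect (forall a a' b b', a \in X -> a' \in X -> b \notin X -> b' \notin X ->
             G a b && G a' b' = G a b' && G a' b)
          (cutrk G X <= 1)%N.
Proof.
(* Over GF(2) a product of entries is a conjunction, so the minor equations become Boolean. *)
have natb (b1 b2 c1 c2 : bool) : (b1%:R * b2%:R == c1%:R * c2%:R :> 'F_2) =
    (b1 && b2 == c1 && c2) by case: b1 b2 c1 c2 => [] [] [] [].
apply: (iffP (mxrank_le1P _)) => [minorX a a' b b' aX a'X bX b'X | minorX i i' j j'].
  have bX' : b \in ~: X by rewrite inE.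
  have b'X' : b' \in ~: X by rewrite inE.
  have := minorX (enum_rank_in aX a) (enum_rank_in aX a')
                 (enum_rank_in bX' b) (enum_rank_in bX' b').
  by rewrite !mxE !enum_rankK_in // => /eqP; rewrite natb => /eqP.
have cX (k : 'I_#|~: X|) : enum_val k \notin X by have := enum_valP k; rewrite inE.
apply/eqP; rewrite !mxE natb; apply/eqP.
by apply: minorX; rewrite ?cX ?enum_valP.
Qed.
End RankOne.

(** * From linear rank decompositions to layouts *)

Lemma connect_cross (T : finType) (e : rel T) (A : {pred T}) x y :
  connect e x y -> x \in A -> y \notin A ->
  exists a b, [/\ e a b, a \in A, b \notin A, connect e x a & connect e x b].
Proof.
case/connectP => p; elim: p x => [|z p IHp] x /= => [_ -> -> //|].
case/andP => exz pathp lastp xA yA; have [zA|zA] := boolP (z \in A).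
  have [a [b [eab aA bA za zb]]] := IHp z pathp lastp zA yA.
  by exists a, b; split=> //; apply: connect_trans (connect1 exz) _.
by exists x, z; split=> //; apply: connect1.
Qed.

Lemma connect_ind (T : finType) (e : rel T) (P : {pred T}) x y :
  (forall a b, a \in P -> e a b -> b \in P) -> connect e x y -> x \in P -> y \in P.
Proof.
move=> closedP xy xP; apply: contraT => /(connect_cross xy xP)[a [b [eab aP]]].
by rewrite (closedP a).
Qed.

(* [f] orders [S] so that every threshold cut has rank at most 1 over GF(2), that is,
   all 2x2 minors across it vanish; only the order of the values of [f] matters. *)
Definition layout (V : finType) (e : rel V) (S : {set V}) (f : V -> nat) :=
  {in S &, injective f} /\
  forall a a' b b', a \in S -> a' \in S -> b \in S -> b' \in S ->
    f a < f b -> f a < f b' -> f a' < f b -> f a' < f b' ->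
    e a b && e a' b' = e a b' && e a' b.

Definition linearizable (V : finType) (e : rel V) (S : {set V}) := exists f, layout e S f.

Section Caterpillar.
Variables (V : finType) (D : lin_rank_dec V).
Notation T := (lrd_tree D).

Lemma edge_deletedC (a b : lrd_node D) : edge_deleted a b =2 edge_deleted b a.
Proof. by move=> x y; rewrite /edge_deleted [[set b; a]]setUC. Qed.

Lemma edge_deleted_sym (a b : lrd_node D) : symmetric (edge_deleted a b).
Proof. by move=> x y; rewrite /edge_deleted adj_sym setUC. Qed.

(** Otherwise a duplicate-free path from [a] to [b] closes up with the edge [ab] to a cycle; it has
    at least three vertices because the path may not use that edge. *)
Lemma tree_bridge (a b : lrd_node D) : T a b -> ~~ connect (edge_deleted a b) a b.
Proof.
move=> Tab; case: (lrd_caterpillar D) => -[_ acyclic] _; apply/negP => /connectP [p0 pth0 lst0].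
have {p0 pth0 lst0} [p [pth lst uniq_p]] : exists p,
    [/\ path (edge_deleted a b) a p, b = last a p & uniq (a :: p)].
  by move: lst0; case/shortenP: pth0 => p pth uniq_p _ lst; exists p.
have pthT : path T a p by apply: sub_path pth => x y /andP [].
apply: (acyclic (a :: p)) => /=.
  case: p pth lst uniq_p {pthT} => [|c [|d p]] //=.
    by move=> _ ba; rewrite ba adj_irr in Tab.
  by rewrite /edge_deleted => /andP [/andP [_ nac] _] bc; rewrite -bc eqxx in nac.
by rewrite /ucycle uniq_p /= rcons_path pthT -lst adj_sym Tab.
Qed.

Lemma mem_edge_side (a b : lrd_node D) (l : {x | pendant T x}) :
  (lrd_label l \in edge_side a b) = connect (edge_deleted a b) a (val l).
Proof.
have [g labelK _] := lrd_label_bij D.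
by rewrite mem_imset ?inE //; apply: can_inj labelK.
Qed.

End Caterpillar.

(** Leaves are ordered along the spine. A threshold between two spine positions is the cut of a
    spine edge. A threshold among the leaves at one spine vertex has only trivial minors, since
    degree 3 leaves no room for two distinct lower and two distinct upper leaves. *)
Lemma linearizable_of_dec (V : finType) (G : sgraph V) (D : lin_rank_dec V) :
  lrd_width G D <= 1 -> linearizable G setT.
Proof.
move=> widthD.
have minorD (a b : lrd_node D) (l l' m m' : {x | pendant (lrd_tree D) x}) :
    lrd_tree D a b ->
    connect (edge_deleted a b) a (val l) -> connect (edge_deleted a b) a (val l') ->
    connect (edge_deleted a b) b (val m) -> connect (edge_deleted a b) b (val m') ->
  G (lrd_label l) (lrd_label m) && G (lrd_label l') (lrd_label m') =
  G (lrd_label l) (lrd_label m') && G (lrd_label l') (lrd_label m).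
  move=> Tab al al' bm bm'.
  have nab := tree_bridge Tab.
  have far (k : {x | pendant (lrd_tree D) x}) :
      connect (edge_deleted a b) b (val k) -> lrd_label k \notin edge_side a b.
    move=> bk; rewrite mem_edge_side; apply: contra nab => ak.
    apply: connect_trans ak _; by rewrite (sym_connect_sym (@edge_deleted_sym _ _ _ _)).
  have /cutrk_le1P flat : cutrk G (edge_side a b) <= 1.
    apply: leq_trans widthD.
    exact: (@leq_bigmax_cond _ (fun ab => lrd_tree D ab.1 ab.2)
              (fun ab => cutrk G (edge_side ab.1 ab.2)) (a, b)).
  by apply: flat; rewrite ?far ?mem_edge_side.
case: (lrd_caterpillar D) => _ [x [p [pth uniqP home_ex]]].
pose N := #|lrd_node D|; set P := x :: p in uniqP home_ex.
pose z i := nth x P i.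
(* The spine vertex at which [l] is attached, or [l] itself on the spine; the default [x] is never
   reached. *)
pose home l := if l \in P then l else odflt x [pick c | (c \in P) && lrd_tree D l c].
have homeP l : home l \in P /\ (l \notin P -> lrd_tree D l (home l)).
  rewrite /home; case: ifP => [//|/negbT/home_ex[c cP lc]].
  by case: pickP => [d /andP[]|/(_ c)] //=; rewrite cP lc.
pose pos l := index (home l) P.
have posP l : pos l < size P by rewrite index_mem; case: (homeP l).
have z_pos l : z (pos l) = home l by rewrite /z nth_index //; case: (homeP l).
have pos_z i : i < size P -> pos (z i) = i.
  by move=> iP; rewrite /pos /home mem_nth // index_uniq.
have zT i : i.+1 < size P -> lrd_tree D (z i) (z i.+1) by move=> iP; apply: (pathP x pth).
have z_inj i j : i < size P -> j < size P -> z i = z j -> i = j.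
  by move=> iP jP eqz; apply/eqP; rewrite -(nth_uniq x iP jP uniqP); apply/eqP.
have zE m i : m.+1 < size P -> i.+1 < size P -> i != m ->
    edge_deleted (z m) (z m.+1) (z i) (z i.+1).
  move=> mP iP nim; rewrite /edge_deleted zT //=; apply: contra nim => /eqP eqz.
  have := set21 (z i) (z i.+1); rewrite eqz => /set2P[/z_inj|/z_inj] iE; first lia.
  by have := set22 (z i) (z i.+1); rewrite eqz => /set2P[/z_inj|/z_inj]; lia.
have chain m i j : m.+1 < size P -> i <= j < size P -> (j <= m) || (m < i) ->
    connect (edge_deleted (z m) (z m.+1)) (z i) (z j).
  move=> mP; elim: j => [|j IHj] ijP side_m.
    by have -> : i = 0 by [lia|]; apply: connect0.
  have [->|nij] := eqVneq i j.+1; first exact: connect0.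
  apply: connect_trans (IHj _ _) (connect1 (zE _ _ _ _ _)); lia.
have home_connect m l : m.+1 < size P ->
    connect (edge_deleted (z m) (z m.+1)) (home l) l.
  move=> mP; have [_ lhome] := homeP l.
  have [lP|lP] := boolP (l \in P); first by rewrite /home lP connect0.
  apply: connect1; rewrite /edge_deleted adj_sym lhome //=.
  apply: contraNneq lP => eqz.
  by have := set22 (home l) l; rewrite eqz => /set2P[->|->]; rewrite mem_nth // ltnW.
have nearP m l : m.+1 < size P -> pos l <= m ->
    connect (edge_deleted (z m) (z m.+1)) (z m) l.
  move=> mP lm; apply: connect_trans (home_connect m l mP).
  rewrite (sym_connect_sym (@edge_deleted_sym _ _ _ _)) -z_pos; apply: chain; lia.
have farP m l : m.+1 < size P -> m < pos l ->
    connect (edge_deleted (z m) (z m.+1)) (z m.+1) l.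
  move=> mP lm; apply: connect_trans (home_connect m l mP).
  by rewrite -z_pos; have := posP l; move=> lP; apply: chain; lia.
have [g labelK gK] := lrd_label_bij D.
(* Lexicographic order: spine position first, then the enumeration rank, which is below [N] and
   makes [f] injective. *)
pose f l := pos l * N + enum_rank l.
have f_pos l l' : f l < f l' -> pos l <= pos l'.
  rewrite /f; have := ltn_ord (enum_rank l); have := ltn_ord (enum_rank l'); rewrite -/N; nia.
exists (fun w => f (val (g w))); split=> [w w' _ _|a0 a0' b0 b0' _ _ _ _].
  move/(congr1 (modn^~ N)); rewrite !modnMDl !modn_small //.
  by move/val_inj/enum_rank_inj/val_inj/(can_inj gK).
rewrite -(gK a0) -(gK a0') -(gK b0) -(gK b0') !labelK.
move: (g a0) (g a0') (g b0) (g b0') => {a0 a0' b0 b0'}.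
move=> a a' b b' fab fab' fa'b fa'b'.
wlog le_a : a a' fab fab' fa'b fa'b' / pos (val a') <= pos (val a).
  move=> hwlog; have /orP[|] := leq_total (pos (val a')) (pos (val a)); first exact: hwlog.
  by move=> le_a; rewrite andbC [RHS]andbC; apply/esym; apply: hwlog.
wlog le_b : b b' fab fab' fa'b fa'b' / pos (val b) <= pos (val b').
  move=> hwlog; have /orP[|] := leq_total (pos (val b)) (pos (val b')); first exact: hwlog.
  by move=> le_b; apply/esym; apply: hwlog.
(* Now [a] is the later lower leaf and [b] the earlier upper one. If their positions differ, the
   spine edge just after [a] cuts both pairs apart; otherwise they share the spine vertex [c]. *)
have := f_pos _ _ fab; rewrite leq_eqVlt => /orP[/eqP eq_m|lt_m]; last first.
  have mP : (pos (val a)).+1 < size P by apply: leq_ltn_trans lt_m (posP _).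
  apply: (minorD (z (pos (val a))) (z (pos (val a)).+1));
    by rewrite ?nearP ?farP ?zT // (leq_trans lt_m).
have [->|naa'] := eqVneq a a'; first by rewrite andbC.
have [->|nbb'] := eqVneq b b'; first by [].
have ne l l' : f l < f l' -> l != l'.
  by apply: contraTneq => ->; rewrite ltnn.
set m := pos (val a) in le_a eq_m; pose c := z m.
have nbr_home l : pos l = m -> l \in c |: nbr (lrd_tree D) c.
  move=> lm; rewrite /c -lm z_pos !inE; have [_ lT] := homeP l.
  have [lP|/lT] := boolP (l \in P); first by rewrite /home lP eqxx.
  by rewrite adj_sym => ->; rewrite orbT.
have leaf_ne (l : {x | pendant (lrd_tree D) x}) : ~~ pendant (lrd_tree D) c -> val l != c.
  by apply: contraNneq => <-; apply: valP.
(* [u] represents [a'] near [c]: it is [a'] itself or the preceding spine vertex. Likewise [w]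
   represents [b']. With [a] and [b] this gives four distinct vertices in the closed neighbourhood
   of [c]. *)
have [u [uc nuc uE]] : exists u, [/\ u \in c |: nbr (lrd_tree D) c,
    ~~ pendant (lrd_tree D) c -> u != c & (pos u < m) \/ u = val a'].
  move: le_a; rewrite leq_eqVlt => /orP[/eqP a'm|lt_a'].
    by exists (val a'); split; [apply: nbr_home | apply: leaf_ne | right].
  have mP := posP (val a); rewrite -/m in mP.
  exists (z m.-1); split; last by left; rewrite pos_z; lia.
    have m1 : m.-1.+1 = m by lia.
    by rewrite !inE adj_sym /c -[X in lrd_tree D _ (z X)]m1 zT ?orbT // m1.
  by move=> _; apply/negP => /eqP /z_inj; lia.
have [w [wc nwc wE]] : exists w, [/\ w \in c |: nbr (lrd_tree D) c,
    ~~ pendant (lrd_tree D) c -> w != c & (m < pos w) \/ w = val b'].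
  move: le_b; rewrite -eq_m leq_eqVlt => /orP[/eqP b'm|lt_b'].
    by exists (val b'); split; [apply: nbr_home | apply: leaf_ne | right].
  have mP := posP (val b').
  exists (z m.+1); split; last by left; rewrite pos_z; lia.
    by rewrite !inE /c zT ?orbT //; lia.
  by move=> _; apply/negP => /eqP /z_inj; lia.
have uniq4 : uniq [:: val a; val b; u; w].
  have ne_pos l l' : pos l < pos l' -> l != l' by apply: contraTneq => ->; rewrite ltnn.
  have au : val a != u by case: uE => [um|->]; [rewrite eq_sym ne_pos | rewrite (inj_eq val_inj)].
  have bu : val b != u.
    by case: uE => [um|->]; rewrite eq_sym; [rewrite ne_pos // -eq_m | apply: ne].
  have aw : val a != w by case: wE => [wm|->]; [apply: ne_pos | apply: ne].
  have bw : val b != w.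
    by case: wE => [wm|->]; [rewrite ne_pos // -eq_m | rewrite (inj_eq val_inj)].
  have uw : u != w.
    case: uE wE => [um|->] [wm|->]; last exact: ne.
    - by apply: ne_pos; apply: ltn_trans um wm.
    - by apply: ne_pos; apply: leq_trans um _; rewrite eq_m.
    by apply: ne_pos; apply: leq_ltn_trans le_a wm.
  by rewrite /= !inE !negb_or (ne _ _ fab) au aw bu bw uw.
have sub4 : {subset [:: val a; val b; u; w] <= c |: nbr (lrd_tree D) c}.
  apply/allP; rewrite /= uc wc !andbT nbr_home //=; exact: nbr_home.
have le4 : 4 <= #|c |: nbr (lrd_tree D) c|.
  by rewrite -[4](card_uniqP uniq4) subset_leq_card //; apply/subsetP.
have c_nbr : c \notin nbr (lrd_tree D) c by rewrite inE adj_irr.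
have [/eqP pc|npc] := boolP (pendant (lrd_tree D) c).
  by move: le4; rewrite cardsU1 c_nbr -/(degree _ _) pc.
have := lrd_cubic npc; rewrite /degree => deg3.
suff : 4 <= #|nbr (lrd_tree D) c| by rewrite deg3.
rewrite -[4](card_uniqP uniq4) subset_leq_card //; apply/subsetP => l l4.
have := sub4 l l4; rewrite in_setU1 => /orP[/eqP lc|//].
by move: l4; rewrite lc !inE !(eq_sym c) !(negPf (leaf_ne _ npc)) (negPf (nuc npc))
  (negPf (nwc npc)).
Qed.

Lemma linearizable_of_le1 (V : finType) (G : sgraph V) :
  linear_rankwidth_le1 G -> linearizable G setT.
Proof.
case=> k; rewrite /linear_rankwidth; case: ifP => [V1 _ _|_ [[D <-] _]]; last first.
  exact: linearizable_of_dec.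
have eqV (x y : V) : x = y by apply: (elimT fintype_le1P V1).
by exists (fun=> 0); split=> [x y _ _ _|a a' b b' _ _ _ _]; [apply: eqV | rewrite ltnn].
Qed.

(** * From layouts to linear rank decompositions *)

Lemma inj_surj_bij (T : choiceType) (U : eqType) (h : T -> U) :
  injective h -> (forall y, exists x, h x = y) -> bijective h.
Proof.
move=> h_inj h_surj.
have hP y : {x | h x == y} by apply: sigW; have [x <-] := h_surj y; exists x.
pose g y := sval (hP y).
have gK : cancel g h by move=> y; apply/eqP; apply: svalP (hP y).
by exists g => // x; apply: h_inj; rewrite gK.
Qed.

(* The path [inl 0], ..., [inl m.+1] with the leaf [inr k] hanging off [inl k.+1]. *)
Definition comb_adj m : rel ('I_m.+2 + 'I_m)%type := fun x y =>
  match x, y with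
  | inl i, inl j => (i.+1 == j) || (j.+1 == i)
  | inl i, inr k | inr k, inl i => i == k.+1 :> nat
  | inr _, inr _ => false
  end.

Lemma comb_adj_sym m : symmetric (@comb_adj m).
Proof. by move=> [i|i] [j|j] //=; rewrite orbC. Qed.

Lemma comb_adj_irr m : irreflexive (@comb_adj m).
Proof. by move=> [i|i] //=; apply/negP; lia. Qed.

Definition comb m := SGraph (@comb_adj_sym m) (@comb_adj_irr m).

(** The pendant vertices take each of the positions 0 to m+1 exactly once; an inner spine vertex
    shares its position with its leg. *)
Definition comb_pos m (x : 'I_m.+2 + 'I_m) : nat :=
  match x with inl i => i | inr k => k.+1 end.

Lemma comb_pos_lt m (x : 'I_m.+2 + 'I_m) : comb_pos x < m.+2.
Proof. by case: x => i /=; have := ltn_ord i; lia. Qed.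

Lemma ucycle_max (N : finType) (e : rel N) (r : N -> nat) (c : seq N) :
  0 < size c -> ucycle e c ->
  exists x p, [/\ ucycle e (x :: p), size (x :: p) = size c & {in x :: p, forall y, r y <= r x}].
Proof.
case: c => // c0 c _ uc.
pose x := [arg max_(y > c0 in c0 :: c) r y].
have [xc max_x] : x \in c0 :: c /\ {in c0 :: c, forall y, r y <= r x}.
  by rewrite /x; case: arg_maxnP => [|y yc max_y]; [apply: mem_head | split=> // z /max_y].
case/rot_to: xc => i p rot_c; exists x, p.
have inc : x :: p =i c0 :: c by move=> y; rewrite -rot_c mem_rot.
split; first by rewrite -rot_c /ucycle rot_cycle rot_uniq.
  by rewrite -rot_c size_rot.
by move=> y; rewrite inc; apply: max_x.
Qed.

Lemma comb_acyclic m (c : seq ('I_m.+2 + 'I_m)) : 2 < size c -> ~ ucycle (comb m) c.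
Proof.
move=> szc uc.
(* Spine vertices are ranked by index, legs above them all. Every vertex then has at most one
   neighbour of rank not above its own, whereas the top vertex of a cycle would have two. *)
pose r (x : 'I_m.+2 + 'I_m) := match x with inl i => val i | inr k => m.+2 end.
have [|x [p [/andP[cyc uniq_p] sz_p max_x]]] := @ucycle_max _ _ r c _ uc; first by case: (c) szc.
case: p sz_p cyc uniq_p max_x => [|y [|z p]]; rewrite /=; try by move=> sz_p; rewrite -sz_p in szc.
move=> _; rewrite rcons_path; set t := last z p => /and3P[xy _ /andP [_ tx]].
move=> /and3P[_ y_zp _] max_x.
have tzp : t \in z :: p by apply: mem_last.
have yt : y != t by apply: contraNneq y_zp => ->.
have := max_x y; have := max_x t; rewrite !inE eqxx !orbT => le_t /(_ isT) le_y.
have {}le_t : r t <= r x by apply: le_t; move: tzp; rewrite inE => ->; rewrite !orbT.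
case/negP: yt; apply/eqP; move: {tzp y_zp max_x} t tx le_t => t tx le_t; move: xy tx le_t le_y.
case: x y t => [i|k] [j|l] [j'|l'] //=; try (have := ltn_ord i; lia).
  by move=> ij ji le_j' le_j; congr inl; apply/val_inj => /=; lia.
by move=> /eqP kj /eqP kj' _ _; congr inl; apply/val_inj; rewrite /= kj kj'.
Qed.

Lemma comb_connected m (x : 'I_m.+2 + 'I_m) : connect (comb m) (inl ord0) x.
Proof.
have spine (i : 'I_m.+2) : connect (comb m) (inl ord0) (inl i).
  case: i => i; elim: i => [|i IHi] lt_i; first by rewrite (_ : Ordinal _ = ord0) //; apply: val_inj.
  by apply: connect_trans (IHi (ltnW lt_i)) (connect1 _); rewrite /= eqxx.
case: x => [i|k]; first exact: spine.
have lt_k : k.+1 < m.+2 by have := ltn_ord k; lia.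
by apply: connect_trans (spine (Ordinal lt_k)) (connect1 _); rewrite /= eqxx.
Qed.

Lemma comb_tree m : is_tree (comb m).
Proof.
split; last exact: comb_acyclic.
split=> [|x y]; first by apply/card_gt0P; exists (inl ord0).
apply: connect_trans (comb_connected y).
rewrite (sym_connect_sym (@comb_adj_sym m)); exact: comb_connected.
Qed.

Lemma comb_caterpillar m : is_caterpillar (comb m).
Proof.
split; first exact: comb_tree.
pose q i : 'I_m.+2 + 'I_m := inl (inord i).
have inP (i : 'I_m.+2) : inl i \in q 0 :: map q (iota 1 m.+1).
  rewrite -[_ :: _]/(map q (iota 0 m.+2)); apply/mapP; exists (val i).
    by rewrite mem_iota /= ltn_ord.
  by rewrite /q inord_val.
exists (q 0), (map q (iota 1 m.+1)); split.
- apply/(pathP (q 0)) => i; rewrite size_map size_iota => lt_i.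
  have qi : nth (q 0) (q 0 :: map q (iota 1 m.+1)) i = q i.
    by rewrite -[_ :: _]/(map q (iota 0 m.+2)) (nth_map 0) ?size_iota ?nth_iota //; lia.
  rewrite qi (nth_map 0) ?size_iota // nth_iota // /= !inordK ?eqxx //; lia.
- rewrite -[_ :: _]/(map q (iota 0 m.+2)) map_inj_in_uniq ?iota_uniq // => i j.
  by rewrite !mem_iota /= => lt_i lt_j [/(congr1 val)] /=; rewrite !inordK.
move=> [i|k]; first by rewrite inP.
have lt_k : k.+1 < m.+2 by have := ltn_ord k; lia.
by move=> _; exists (inl (Ordinal lt_k)); [apply: inP | rewrite /= eqxx].
Qed.

Lemma comb_inner_degree m (i : 'I_m.+2) :
  i != 0 :> nat -> i != m.+1 :> nat -> degree (comb m) (inl i) = 3.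
Proof.
have lt_i := ltn_ord i; case: m i lt_i => [|m] i lt_i i0 im; first by lia.
pose l : seq ('I_m.+3 + 'I_m.+1) :=
  [:: inl (inord i.-1); inl (inord i.+1); inr (inord i.-1)].
have uniq_l : uniq l.
  rewrite /= !inE (inj_eq inl_inj) -val_eqE /= !inordK; try lia.
  by rewrite orbF andbT; lia.
rewrite /degree -[3]/(size l) -(card_uniqP uniq_l); apply: eq_card.
case=> [j|k]; rewrite !inE /= ?(inj_eq inl_inj) ?(inj_eq inr_inj) -!val_eqE /= !inordK //;
  rewrite ?orbF; first [have := ltn_ord j; lia | have := ltn_ord k; lia | lia].
Qed.

Lemma comb_pendant_spine m (i : 'I_m.+2) :
  pendant (comb m) (inl i) = (i == 0 :> nat) || (i == m.+1 :> nat).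
Proof.
have lt_i := ltn_ord i.
have [i0|i0] := eqVneq (val i) 0 => /=.
  apply/eqP; rewrite /degree (_ : nbr _ _ = [set inl (inord 1)]) ?cards1 //.
  apply/setP => -[j|k]; rewrite !inE /= ?i0 //.
  by rewrite (inj_eq inl_inj) -val_eqE /= inordK //; lia.
have [im|im] := eqVneq (val i) m.+1 => /=.
  apply/eqP; rewrite /degree (_ : nbr _ _ = [set inl (inord m)]) ?cards1 //.
  apply/setP => -[j|k]; rewrite !inE /= ?im.
    by rewrite (inj_eq inl_inj) -val_eqE /= inordK //; have := ltn_ord j; lia.
  by apply: (introF eqP) => ik; have := ltn_ord k; lia.
by rewrite /pendant comb_inner_degree ?i0 ?im.
Qed.

Lemma comb_pendant_leg m (k : 'I_m) : pendant (comb m) (inr k).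
Proof.
apply/eqP; rewrite /degree (_ : nbr _ _ = [set inl (inord k.+1)]) ?cards1 //.
have lt_k := ltn_ord k.
apply/setP => -[j|l]; rewrite !inE //= (inj_eq inl_inj) -val_eqE /= inordK //; lia.
Qed.

Lemma comb_cubic m (x : 'I_m.+2 + 'I_m) : ~~ pendant (comb m) x -> degree (comb m) x = 3.
Proof.
case: x => [i|k]; last by rewrite comb_pendant_leg.
rewrite comb_pendant_spine negb_or => /andP[]; exact: comb_inner_degree.
Qed.

Lemma comb_pos_inj m (x y : {x | pendant (comb m) x}) :
  comb_pos (val x) = comb_pos (val y) -> x = y.
Proof.
move=> eq_pos; apply: val_inj; case: x y eq_pos => [[i|k] /= px] [[j|l] /= py] eq_pos.
- by congr inl; apply: val_inj.
- by move: px; rewrite comb_pendant_spine; have := ltn_ord l; lia.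
- by move: py; rewrite comb_pendant_spine; have := ltn_ord k; lia.
by congr inr; apply: val_inj; case: eq_pos.
Qed.

Lemma comb_pos_surj m i : i < m.+2 -> exists x : {x | pendant (comb m) x}, comb_pos (val x) = i.
Proof.
move=> lt_i; have [spine|] := boolP (pendant (comb m) (inl (Ordinal lt_i))).
  by exists (exist (fun x => pendant (comb m) x) _ spine).
rewrite comb_pendant_spine negb_or /= => /andP[i0 im].
have lt_i1 : i.-1 < m by lia.
by exists (exist (fun x => pendant (comb m) x) _ (comb_pendant_leg (Ordinal lt_i1))) => /=; lia.
Qed.

(** * Cuts along the edges of the comb *)

Lemma comb_pos_before m (i j : 'I_m.+2) (x : 'I_m.+2 + 'I_m) : i.+1 = j ->
  connect (fun x y => comb m x y && ([set x; y] != [set inl i; inl j])) (inl i) x ->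
  comb_pos x <= i.
Proof.
move=> ij /(@connect_ind _ _ [pred x | comb_pos x <= i]); apply; last by rewrite inE.
move=> {x} [x|k] [y|l]; rewrite !inE => le_x /andP[/= xy]; try by move: xy le_x => /=; lia.
apply: contraNT; rewrite -ltnNge /= => lt_y; rewrite /= in le_x.
by have [-> ->] : x = i /\ y = j by split; apply: val_inj => /=; lia.
Qed.

Lemma comb_pos_after m (i j : 'I_m.+2) (x : 'I_m.+2 + 'I_m) : i.+1 = j ->
  connect (fun x y => comb m x y && ([set x; y] != [set inl i; inl j])) (inl j) x ->
  i < comb_pos x.
Proof.
move=> ij /(@connect_ind _ _ [pred x | i < comb_pos x]); apply; last by rewrite inE /= -ij.
move=> {x} [x|k] [y|l]; rewrite !inE => lt_x /andP[/= xy]; try by move: xy lt_x => /=; lia.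
apply: contraNT; rewrite -leqNgt /= => le_y; rewrite /= in lt_x.
have [-> ->] : x = j /\ y = i by split; apply: val_inj => /=; lia.
by rewrite setUC.
Qed.

Lemma comb_leg_alone m (i : 'I_m.+2) (k : 'I_m) (x : 'I_m.+2 + 'I_m) : i = k.+1 :> nat ->
  connect (fun x y => comb m x y && ([set x; y] != [set inl i; inr k])) (inr k) x ->
  x = inr k.
Proof.
move=> ik /(@connect_ind _ _ (pred1 (inr k))) => /(_ _ (eqxx _)) E; apply/eqP; apply: E.
move=> a [y|l] /eqP -> /=; last by [].
move=> /andP[yk] ; rewrite (_ : y = i) 1?setUC ?eqxx //; apply: val_inj => /=; lia.
Qed.

Lemma tree_side (V : finType) (D : lin_rank_dec V) (a b x : lrd_node D) :
  lrd_tree D a b ->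
  connect (edge_deleted a b) a x \/ connect (edge_deleted a b) b x.
Proof.
move=> Tab; case: (lrd_caterpillar D) => [[[_ conn] _] _].
pose P := [pred y | connect (edge_deleted a b) a y || connect (edge_deleted a b) b y].
suff /orP : x \in P by [].
apply: (connect_ind _ (conn a x)); last by rewrite inE connect0.
move=> y z; rewrite !inE => yP Tyz.
have [eqS|neS] := eqVneq [set y; z] [set a; b].
  have : z \in [set a; b] by rewrite -eqS set22.
  by case/set2P=> ->; rewrite connect0 ?orbT.
have yz : connect (edge_deleted a b) y z by apply: connect1; rewrite /edge_deleted Tyz.
by case/orP: yP => /connect_trans/(_ yz) ->; rewrite ?orbT.
Qed.

(** The vertices sorted by [f] label the leaves of the comb from left to right. A spine edge then
    realises a threshold cut, and a leg edge has a single leaf on one side, which leaves only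
    trivial minors. *)
Lemma dec_of_layout (V : finType) (G : sgraph V) (f : V -> nat) :
  2 <= #|V| -> layout G setT f -> exists D : lin_rank_dec V, lrd_width G D <= 1.
Proof.
case cardV: #|V| => [|[|m]] // _ [f_inj f_minor].
have [x0 _] : exists x : V, x \in V by apply/card_gt0P; rewrite cardV.
pose s := sort (fun x y => f x <= f y) (enum V).
have size_s : size s = m.+2 by rewrite size_sort -cardE.
have uniq_s : uniq s by rewrite sort_uniq enum_uniq.
have mem_s x : x \in s by rewrite mem_sort mem_enum.
have mono_s i j : i < j < m.+2 -> f (nth x0 s i) < f (nth x0 s j).
  move=> /andP[lt_ij lt_j]; have lt_i := ltn_trans lt_ij lt_j.
  have le_f : f (nth x0 s i) <= f (nth x0 s j).
    apply: (@sorted_leq_nth _ (fun x y => f x <= f y)); rewrite ?inE ?size_s //; last exact: ltnW.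
    - by move=> y x z; apply: leq_trans.
    - by apply: sort_sorted => x y; apply: leq_total.
  rewrite ltn_neqAle le_f andbT; apply: contraTneq lt_ij => /f_inj -/(_ (in_setT _) (in_setT _)) /eqP.
  by rewrite nth_uniq ?size_s // => /eqP ->; rewrite ltnn.
pose label (l : {x | pendant (comb m) x}) := nth x0 s (comb_pos (val l)).
have label_bij : bijective label.
  apply: inj_surj_bij => [l l' /eqP|y].
    by rewrite nth_uniq ?size_s ?comb_pos_lt // => /eqP/comb_pos_inj.
  have := mem_s y; rewrite -index_mem size_s => /comb_pos_surj[l pos_l].
  by exists l; rewrite /label pos_l nth_index.
have size_comb : 2 <= #|{: 'I_m.+2 + 'I_m}| by rewrite card_sum !card_ord.
exists (LinRankDec (comb_caterpillar m) size_comb (@comb_cubic m) label_bij).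
set D := LinRankDec _ _ _ _; apply/bigmax_leqP => -[a b] /= Tab; apply/cutrk_le1P.
have far (l : {x | pendant (comb m) x}) : ~~ connect (@edge_deleted _ D a b) a (val l) ->
    connect (@edge_deleted _ D a b) b (val l).
  by case: (@tree_side _ D a b (val l) Tab) => [->|].
have minor_lt (l l' k k' : {x | pendant (comb m) x}) i :
    comb_pos (val l) <= i -> comb_pos (val l') <= i ->
    i < comb_pos (val k) -> i < comb_pos (val k') ->
    G (label l) (label k) && G (label l') (label k') =
    G (label l) (label k') && G (label l') (label k).
  by move=> *; apply: f_minor; rewrite ?in_setT // mono_s // comb_pos_lt andbT;
     apply: leq_ltn_trans; eauto.
move=> c c' d d'; have [g _ gK] := label_bij.
rewrite -(gK c) -(gK c') -(gK d) -(gK d'); move: (g c) (g c') (g d) (g d') => {c c' d d'} l l' k k'.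
rewrite !(@mem_edge_side _ D) => al al' /far bk /far bk'.
have flip x y u v :
    connect (@edge_deleted _ D u v) x y -> connect (@edge_deleted _ D v u) x y.
  by rewrite (eq_connect (edge_deletedC _ _)).
case: a b Tab al al' bk bk' {far} => [i|k0] [j|l0] //=.
- case/orP => /eqP ij al al' bk bk'.
    apply: (minor_lt _ _ _ _ i).
    + exact: comb_pos_before ij al.
    + exact: comb_pos_before ij al'.
    + exact: comb_pos_after ij bk.
    + exact: comb_pos_after ij bk'.
  move/flip in al; move/flip in al'; move/flip in bk; move/flip in bk'.
  rewrite ![G (label l) _]adj_sym ![G (label l') _]adj_sym [RHS]andbC.
  apply: (minor_lt _ _ _ _ j).
  + exact: comb_pos_before ij bk.
  + exact: comb_pos_before ij bk'.
  + exact: comb_pos_after ij al.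
  + exact: comb_pos_after ij al'.
- move=> /eqP il _ _ bk bk'.
  have -> : k = k'.
    apply: val_inj; exact: etrans (comb_leg_alone il bk) (esym (comb_leg_alone il bk')).
  by [].
move=> /eqP jk /flip al /flip al' _ _.
have -> : l = l'.
  apply: val_inj; exact: etrans (comb_leg_alone jk al) (esym (comb_leg_alone jk al')).
by rewrite andbC.
Qed.

(** A layout yields a decomposition of width at most 1, so the minimum is 0 or 1 according to
    whether some decomposition has width 0. *)
Lemma not_linearizable (V : finType) (G : sgraph V) :
  ~ linear_rankwidth_le1 G -> ~ linearizable G setT.
Proof.
move=> notG [f layf]; have [V1|V2] := leqP #|V| 1.
  by apply: notG; exists 0 => //; rewrite /linear_rankwidth V1.
have [D widthD] := dec_of_layout V2 layf.
have rwP k : linear_rankwidth G k <-> (exists D : lin_rank_dec V, lrd_width G D = k) /\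
       (forall D : lin_rank_dec V, k <= lrd_width G D).
  by rewrite /linear_rankwidth leqNgt V2.
have not0 (D' : lin_rank_dec V) : 0 < lrd_width G D'.
  rewrite lt0n; apply/eqP => D'0; apply: notG; exists 0 => //.
  by apply/rwP; split=> //; exists D'.
apply: notG; exists 1 => //; apply/rwP; split=> //; exists D.
by apply/eqP; rewrite eqn_leq widthD not0.
Qed.

(** * Layouts *)

Lemma layout_sub (V : finType) (e : rel V) (S S' : {set V}) f :
  S' \subset S -> layout e S f -> layout e S' f.
Proof.
move=> /subsetP sub [f_inj f_minor]; split=> [x y /sub xS /sub yS|]; first exact: f_inj.
by move=> a a' b b' /sub aS /sub a'S /sub bS /sub b'S; apply: f_minor.
Qed.

Lemma linearizable_sub (V : finType) (e : rel V) (S S' : {set V}) :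
  S' \subset S -> linearizable e S -> linearizable e S'.
Proof. by move=> sub [f layf]; exists f; apply: layout_sub layf. Qed.

Lemma linearizable_delete (V : finType) (G : sgraph V) (S : {set V}) :
  linearizable (delete G S) setT -> linearizable G (~: S).
Proof.
case=> f [f_inj f_minor].
pose g x := if insub x is Some y then f y else 0.
have gE x (xS : x \in ~: S) : {y : {x | x \notin S} | val y = x & g x = f y}.
  have xS' : x \notin S by rewrite inE in xS.
  by exists (Sub x xS'); rewrite ?SubK // /g insubT.
exists g; split=> [x y /gE[x' <- ->] /gE[y' <- ->] /f_inj -> //|].
move=> a a' b b' /gE[c <- ->] /gE[c' <- ->] /gE[d <- ->] /gE[d' <- ->].
exact: f_minor.
Qed.

Section Layouts.
Variables (V : finType) (G : sgraph V).
Implicit Types (A B S : {set V}) (f g : V -> nat).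

Lemma layout_rev S f : layout G S f ->
  exists2 g, layout G S g & forall x y, (g x < g y) = (f y < f x).
Proof.
case=> f_inj f_minor; pose M := \max_x f x.
have f_le x : f x <= M by apply: leq_bigmax.
exists (fun x => M - f x); last by move=> x y; have := f_le x; have := f_le y; lia.
split=> [x y xS yS eqf|a a' b b' aS a'S bS b'S].
  by apply: f_inj => //; have := f_le x; have := f_le y; lia.
have := f_le a; have := f_le a'; have := f_le b; have := f_le b' => *.
rewrite ![G a _]adj_sym ![G a' _]adj_sym [RHS]andbC.
by apply: f_minor => //; lia.
Qed.

Definition sees_only S p v := forall z, z \in S -> G p z = (z == v).

(** An edge [ab] passing over [v] would form a nonzero minor with the edge [pv], on whichever side
    of [v] the vertex [p] lies. *)
Lemma pendant_split S f p v : layout G S f -> p \in S -> v \in S -> sees_only S p v ->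
  forall a b, a \in S -> b \in S -> f a < f v -> f v < f b -> ~~ G a b.
Proof.
case=> f_inj f_minor pS vS p_v a b aS bS fav fvb.
have npv : p != v by apply/eqP => pv; move: (p_v v vS); rewrite pv adj_irr eqxx.
have fpv : f p != f v by apply: contraNneq npv => /f_inj->.
have pv : G p v by rewrite p_v.
have pb : G p b = false by rewrite p_v //; apply: contraTF fvb => /eqP->; rewrite ltnn.
have pa : G p a = false by rewrite p_v //; apply: contraTF fav => /eqP->; rewrite ltnn.
move: fpv; rewrite neq_ltn => /orP[fpv|fvp].
  have := f_minor a p v b aS pS vS bS fav (ltn_trans fav fvb) fpv (ltn_trans fpv fvb).
  by rewrite pb pv andbF andbT => <-.
have := f_minor a v b p aS vS bS pS (ltn_trans fav fvb) (ltn_trans fav fvp) fvb fvp.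
by rewrite (adj_sym G v p) pv (adj_sym G a p) pa andbT /= => ->.
Qed.

Lemma add_pendant S f q v : layout G S f -> v \in S -> q \notin S ->
  (forall a b, a \in S -> b \in S -> f a < f v -> f v < f b -> ~~ G a b) ->
  sees_only S q v -> linearizable G (q |: S).
Proof.
case=> f_inj f_minor vS qS split_v q_v.
(* Doubling the values makes room for [q] immediately after [v]. *)
pose g x := if x == q then (f v).*2.+1 else (f x).*2.
have gq : g q = (f v).*2.+1 by rewrite /g eqxx.
have gS x : x \in S -> g x = (f x).*2.
  by move=> xS; rewrite /g ifN //; apply: contraNneq qS => <-.
exists g; split.
  move=> x y /setU1P[->|xS] /setU1P[->|yS]; rewrite ?gq ?gS //; try lia.
  by move=> eqf; apply: f_inj => //; lia.
have q_far b : b \in S -> g q < g b -> G q b = false.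
  by move=> bS; rewrite gq gS // q_v //; case: eqP => // ->; lia.
(* The column of [q] is nonzero only at [v]; if one lower vertex is [v], an edge from the other one
   to [b] would pass over [v]. *)
have half a b b' : a \in S -> b \in S -> b' = q ->
  forall a', a' \in S -> g a < g b -> g a < g b' -> g a' < g b -> g a' < g b' ->
    G a b && G a' b' = G a b' && G a' b.
  move=> aS bS -> a' a'S; rewrite gq !gS // => ab aq a'b a'q.
  rewrite (adj_sym G a' q) (adj_sym G a q) !q_v //.
  have [av|av] := eqVneq a v; have [a'v|a'v] := eqVneq a' v; rewrite ?andbT ?andbF //=.
  - by rewrite av a'v.
  - apply/esym/negbTE/split_v => //; last by rewrite -av; lia.
    rewrite ltn_neqAle; apply/andP; split; last by lia.
    by apply: contraNneq a'v => /f_inj->.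
  apply/negbTE/split_v => //; last by rewrite -a'v; lia.
  rewrite ltn_neqAle; apply/andP; split; last by lia.
  by apply: contraNneq av => /f_inj->.
have top a b b' : b \in q |: S -> b' \in q |: S -> g q < g b -> g q < g b' ->
    G q b && G a b' = G q b' && G a b.
  by move=> /setU1P[->|bS] /setU1P[->|b'S] qb qb'; rewrite ?q_far //; move: qb qb'; rewrite ltnn.
move=> a a' b b' aqS a'qS bqS b'qS ab ab' a'b a'b'.
case/setU1P: (aqS) ab ab' => [->|aS] ab ab'; first exact: top.
case/setU1P: (a'qS) a'b a'b' => [->|a'S] a'b a'b'; first by rewrite andbC [RHS]andbC top.
case/setU1P: (b'qS) ab' a'b' => [->|b'S] ab' a'b'.
  case/setU1P: (bqS) ab a'b => [-> //|bS] ab a'b; exact: half.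
case/setU1P: (bqS) ab a'b => [->|bS] ab a'b; first by apply/esym; apply: half.
have lt_f x y : x \in S -> y \in S -> g x < g y -> f x < f y.
  by move=> xS yS; rewrite !gS // ltn_double.
by apply: f_minor => //; exact: lt_f.
Qed.

(** The second layout is shifted so that both agree at [v]. At a threshold before [v] the columns in
    [B] vanish, and after [v] the rows in [A] vanish towards [B], so every nontrivial minor lies
    within one of the given layouts. *)
Lemma layout_cat A B v f g :
    layout G (v |: A) f -> {in A, forall a, f a < f v} ->
    layout G (v |: B) g -> {in B, forall b, g v < g b} ->
    [disjoint A & B] -> {in A & B, forall a b, ~~ G a b} ->
  exists2 h, layout G (v |: (A :|: B)) h &
    {in A, forall a, h a < h v} /\ {in B, forall b, h v < h b}.
Proof.
move=> [f_inj f_minor] fA [g_inj g_minor] gB dAB nAB.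
have vA : v \notin A by apply/negP => /fA; rewrite ltnn.
have vB : v \notin B by apply/negP => /gB; rewrite ltnn.
have BA b : b \in B -> b \notin A by move=> bB; rewrite (disjointFl dAB).
pose h x := if x \in A then f x else f v + (g x - g v).
have hv : h v = f v by rewrite /h (negPf vA) subnn addn0.
have hL x : x \in v |: A -> h x = f x /\ f x <= f v.
  by case/setU1P=> [->|xA]; rewrite ?hv // /h xA ltnW ?fA.
have hR x : x \in v |: B -> h x + g v = f v + g x /\ g v <= g x.
  case/setU1P=> [->|xB]; first by rewrite hv.
  by have := gB x xB; rewrite /h (negPf (BA x xB)); lia.
have vL := setU11 v A; have vR := setU11 v B.
have AL x : x \in A -> x \in v |: A by apply: setU1r.
have BR x : x \in B -> x \in v |: B by apply: setU1r.
have splitP x : x \in v |: (A :|: B) -> x \in v |: A \/ x \in B.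
  by rewrite !inE => /or3P[]->; rewrite ?orbT; auto.
have below a b : a \in v |: (A :|: B) -> b \in v |: A -> h a < h b -> a \in A.
  move=> /splitP[/setU1P[->|//]|aB] bL; first by rewrite hv; case: (hL b bL) => ->; lia.
  by have [] := hR a (BR a aB); have [-> ] := hL b bL; have := gB a aB; lia.
exists h; last first.
  split=> [a aA|b bB]; first by rewrite hv; case: (hL a (AL a aA)) => -> _; apply: fA.
  by rewrite hv; have := hR b (BR b bB); have := gB b bB; lia.
have sep_lt x y : x \in v |: A -> y \in B -> h x < h y.
  by move=> xL yB; have := hL x xL; have := hR y (BR y yB); have := gB y yB; lia.
split.
  move=> x y /splitP[xL|xB] /splitP[yL|yB] eqh.
  - by apply: f_inj => //; case: (hL x xL) (hL y yL) => <- _ [<- _].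
  - by have := sep_lt x y xL yB; rewrite eqh ltnn.
  - by have := sep_lt y x yL xB; rewrite eqh ltnn.
  by apply: g_inj; rewrite ?BR //; have := hR x (BR x xB); have := hR y (BR y yB); lia.
have zero a a' b b' : a \in A -> a' \in A -> b \in B ->
    G a b && G a' b' = G a b' && G a' b.
  by move=> aA a'A bB; rewrite (negPf (nAB a b _ _)) ?(negPf (nAB a' b _ _)) ?andbF.
move=> a a' b b' aS a'S bS b'S ab ab' a'b a'b'.
case: (splitP b bS) => [bL|bB].
  have aA := below a b aS bL ab; have a'A := below a' b a'S bL a'b.
  case: (splitP b' b'S) => [b'L|b'B]; last by apply/esym; apply: zero.
  have [ea _] := hL a (AL a aA); have [ea' _] := hL a' (AL a' a'A).
  have [eb _] := hL b bL; have [eb' _] := hL b' b'L.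
  by apply: f_minor; first [exact: AL | by [] | rewrite -?ea -?ea' -?eb -?eb'].
case: (splitP b' b'S) => [b'L|b'B].
  have aA := below a b' aS b'L ab'; have a'A := below a' b' a'S b'L a'b'.
  exact: zero.
have zero1 c d d' : c \in A -> d \in B -> d' \in B -> G c d = false /\ G c d' = false.
  by move=> cA dB d'B; rewrite !(negPf (nAB _ _ _ _)).
have right x : x \in v |: (A :|: B) -> x \in A \/ x \in v |: B.
  by rewrite !inE => /or3P[]->; rewrite ?orbT; auto.
case: (right a aS) => [aA|aR]; first by have [-> ->] := zero1 a b b' aA bB b'B.
case: (right a' a'S) => [a'A|a'R].
  by have [-> ->] := zero1 a' b b' a'A bB b'B; rewrite !andbF.
have lt_g x y : x \in v |: B -> y \in v |: B -> h x < h y -> g x < g y.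
  by move=> /hR[xE _] /hR[yE _]; rewrite -(ltn_add2r (g v)) xE yE ltn_add2l.
by apply: g_minor => //; first [exact: BR | apply: lt_g => //; exact: BR].
Qed.

(** A certificate against layouts: it speaks of all flat cuts of [S], hence of the thresholds of
    every layout, without fixing an order. *)
Definition separates S p q r s := forall A : {set V},
  (forall a a' b b', a \in S -> a' \in S -> b \in S -> b' \in S ->
     a \in A -> a' \in A -> b \notin A -> b' \notin A ->
     G a b && G a' b' = G a b' && G a' b) ->
  (p \in A) != (q \in A) -> (r \in A) = (s \in A).

Lemma separatesC S p q r s : separates S p q r s -> separates S p q s r.
Proof. by move=> sep A flatA npq; apply/esym; apply: sep. Qed.

(* The complement of a flat cut is flat, so only one orientation of [p, q] matters. *)
Lemma separatesI S p q r s :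
  (forall A : {set V},
    (forall a a' b b', a \in S -> a' \in S -> b \in S -> b' \in S ->
       a \in A -> a' \in A -> b \notin A -> b' \notin A ->
       G a b && G a' b' = G a b' && G a' b) ->
    p \in A -> q \notin A -> (r \in A) = (s \in A)) ->
  separates S p q r s.
Proof.
move=> sep A flatA; have [pA|pA] := boolP (p \in A) => npq.
  by apply: sep => //; move: npq; case: (q \in A).
suff : (r \in ~: A) = (s \in ~: A) by rewrite !inE => /negb_inj.
apply: sep; rewrite ?inE ?pA //.
move=> a a' b b' aS a'S bS b'S; rewrite !inE !negbK => aA a'A bA b'A.
rewrite ![G a _]adj_sym ![G a' _]adj_sym [RHS]andbC; exact: flatA.
Qed.

(** In any order one of the three [x] vertices lies between the other two. The threshold just before
    or just after it, chosen to cut it from its partner [y], also cuts the other two apart. *)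
Lemma not_linearizable_three S x1 y1 x2 y2 x3 y3 :
    [/\ x1 \in S, x2 \in S & x3 \in S] -> [/\ y1 \in S, y2 \in S & y3 \in S] ->
    [/\ x1 != x2, x1 != x3 & x2 != x3] -> [/\ x1 != y1, x2 != y2 & x3 != y3] ->
    separates S x1 y1 x2 x3 -> separates S x2 y2 x1 x3 -> separates S x3 y3 x1 x2 ->
  ~ linearizable G S.
Proof.
move=> [x1S x2S x3S] [y1S y2S y3S] [n12 n13 n23] [n1 n2 n3] sep1 sep2 sep3 [f [f_inj f_minor]].
have mid x y r s : x \in S -> y \in S -> x != y -> separates S x y r s ->
    f r < f x -> f x < f s -> False.
  move=> xS yS nxy sep rx xs.
  have [yx|xy] : f y < f x \/ f x < f y.
    by apply/orP; rewrite -neq_ltn eq_sym; apply: contraNneq nxy => /f_inj->.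
    have : (r \in [set z | f z < f x]) = (s \in [set z | f z < f x]).
      apply: sep; last by rewrite !inE ltnn yx.
      move=> a a' b b' aS a'S bS b'S; rewrite !inE -!leqNgt => ax a'x xb xb'.
      by apply: f_minor => //; apply: leq_trans xb || apply: leq_trans xb'.
    by rewrite !inE rx ltnNge (ltnW xs).
  have : (r \in [set z | f z <= f x]) = (s \in [set z | f z <= f x]).
    apply: sep; last by rewrite !inE leqnn leqNgt xy.
    move=> a a' b b' aS a'S bS b'S; rewrite !inE -!ltnNge => ax a'x xb xb'.
    by apply: f_minor => //; apply: leq_ltn_trans xb || apply: leq_ltn_trans xb'.
  by rewrite !inE (ltnW rx) leqNgt xs.
have cmp x y : x \in S -> y \in S -> x != y -> f x < f y \/ f y < f x.
  by move=> xS yS nxy; apply/orP; rewrite -neq_ltn; apply: contraNneq nxy => /f_inj->.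
have [l12|l21] := cmp x1 x2 x1S x2S n12.
  have [l23|l32] := cmp x2 x3 x2S x3S n23; first exact: (mid x2 y2 x1 x3).
  have [l13|l31] := cmp x1 x3 x1S x3S n13; first exact: (mid x3 y3 x1 x2).
  exact: (mid x1 y1 x3 x2) (separatesC sep1) l31 l12.
have [l13|l31] := cmp x1 x3 x1S x3S n13; first exact: (mid x1 y1 x2 x3).
have [l23|l32] := cmp x2 x3 x2S x3S n23.
  exact: (mid x3 y3 x2 x1) (separatesC sep3) l23 l31.
exact: (mid x2 y2 x3 x1) (separatesC sep2) l32 l21.
Qed.

Definition within (D : {set V}) : rel V := fun x y => [&& x \in D, y \in D & G x y].

Lemma within_sym (D : {set V}) : symmetric (within D).
Proof. by move=> x y; rewrite /within adj_sym andbCA. Qed.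

(** A flat cut between [x] and [y] that also splits [r] from [s] is crossed by an edge inside [D].
    Together with the edge [xy] it gives a nonzero minor, because [y] sees only [x] and [D] avoids
    [x]. *)
Lemma pendant_separates S (D : {set V}) (x y r s : V) :
    x \in S -> y \in S -> sees_only S y x -> D \subset S -> x \notin D ->
    connect (within D) r s -> separates S x y r s.
Proof.
move=> xS yS y_x /subsetP DS xD.
have cross (A : {set V}) u v : connect (within D) u v ->
    (forall a a' b b', a \in S -> a' \in S -> b \in S -> b' \in S ->
       a \in A -> a' \in A -> b \notin A -> b' \notin A ->
       G a b && G a' b' = G a b' && G a' b) ->
    x \in A -> y \notin A -> (u \in A) -> (v \notin A) -> False.
  move=> uv flatA xA yA uA vA.
  have [a [b [/and3P[aD bD ab] aA bA _ _]]] := connect_cross uv uA vA.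
  have := flatA x a y b xS (DS a aD) yS (DS b bD) xA aA yA bA.
  have nax : a != x by apply: contraNneq xD => <-.
  by rewrite (adj_sym G x y) (adj_sym G a y) (y_x x xS) (y_x a (DS a aD)) eqxx ab (negPf nax) andbF.
move=> rs; apply: separatesI => A flatA xA yA.
have sr : connect (within D) s r by rewrite (sym_connect_sym (@within_sym D)).
have [rA|rA] := boolP (r \in A); have [sA|sA] := boolP (s \in A) => //.
  by case: (cross A r s).
by case: (cross A s r).
Qed.

End Layouts.

(** * Obstructions *)

Definition critical (V : finType) (G : sgraph V) :=
  ~ linearizable G setT /\
  forall s v, linearizable (foldl (@local_complement V) G s) [set~ v].

Lemma critical_obstruction (V : finType) (G : sgraph V) :
  obstruction linear_rankwidth_le1 G -> critical G.
Proof.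
move=> obsG; split.
  by apply: not_linearizable; case: (obsG G) => //; exists [::].
move=> s v; apply: linearizable_delete; apply: linearizable_of_le1.
by case: (obsG (foldl (@local_complement V) G s)) => [|_]; [exists s | apply].
Qed.

Section Critical.
Variables (V : finType) (G : sgraph V).
Hypothesis critG : critical G.

Lemma critical_sub (S : {set V}) v : v \notin S -> linearizable G S.
Proof.
move=> vS; apply: linearizable_sub (critG.2 [::] v).
by apply/subsetP => x xS; rewrite !inE; apply: contraNneq vS => <-.
Qed.

(** On at most two vertices every order is a layout, since a nontrivial minor involves at least
    three. *)
Lemma critical_card : 2 < #|V|.
Proof.
rewrite ltnNge; apply/negP => le2; apply: critG.1.
exists (fun x => nat_of_ord (enum_rank x)); split=> [x y _ _ /val_inj/enum_rank_inj //|].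
move=> a a' b b' _ _ _ _ ab ab' a'b a'b'.
have [->|naa'] := eqVneq a a'; first by rewrite andbC.
have ne x y : nat_of_ord (enum_rank x) < enum_rank y -> x != y by apply: contraTneq => ->; rewrite ltnn.
have /card_uniqP card3 : uniq [:: a; a'; b] by rewrite /= !inE negb_or naa' !ne.
by have := max_card (mem [:: a; a'; b]); rewrite card3 leqNgt /= (leq_ltn_trans le2).
Qed.

(** Otherwise the component of [x] and its complement each miss a vertex, so both have layouts, and
    one placed after the other lays out [G]. *)
Lemma critical_connect x y : connect G x y.
Proof.
apply/negPn/negP => nxy; apply: critG.1.
pose A := [set z | connect G x z].
have [f [f_inj f_minor]] : linearizable G A by apply: (@critical_sub _ y); rewrite inE.
have [g [g_inj g_minor]] : linearizable G (~: A).
  by apply: (@critical_sub _ x); rewrite !inE connect0.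
have nAB a b : a \in A -> b \notin A -> G a b = false.
  rewrite !inE => xa nxb; apply: contraNF nxb => /(@connect1 _ G); exact: connect_trans.
pose M := \max_z f z; pose h z := if z \in A then f z else (M + g z).+1.
have f_le z : f z <= M by apply: leq_bigmax.
have hA z : z \in A -> h z = f z by rewrite /h => ->.
have hB z : z \notin A -> h z = (M + g z).+1 by rewrite /h => /negPf ->.
exists h; split=> [u w _ _|a a' b b' _ _ _ _].
  have [uA|uA] := boolP (u \in A); have [wA|wA] := boolP (w \in A).
  - by rewrite !hA //; apply: f_inj.
  - by rewrite hA // hB // => fu; have := f_le u; rewrite fu ltnNge leq_addr.
  - by rewrite hB // hA // => fw; have := f_le w; rewrite -fw ltnNge leq_addr.
  by rewrite !hB // => -[/addnI]; apply: g_inj; rewrite inE.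
have below c d : h c < h d -> d \in A -> c \in A.
  move=> cd dA; apply: contraLR cd => cA; rewrite (hA _ dA) (hB _ cA).
  by rewrite -leqNgt (leq_trans (f_le d)) // leqW // leq_addr.
move=> ab ab' a'b a'b'.
have [bA|bA] := boolP (b \in A).
  have aA := below _ _ ab bA; have a'A := below _ _ a'b bA.
  have [b'A|b'A] := boolP (b' \in A); last by rewrite !(nAB _ b') ?andbF.
  by apply: f_minor; rewrite // -!hA.
have [b'A|b'A] := boolP (b' \in A).
  have aA := below _ _ ab' b'A; have a'A := below _ _ a'b' b'A.
  by rewrite !(nAB _ b) ?andbF.
have [aA|aA] := boolP (a \in A); first by rewrite !(nAB a).
have [a'A|a'A] := boolP (a' \in A); first by rewrite !(nAB a') ?andbF.
have lt_g c d : c \notin A -> d \notin A -> h c < h d -> g c < g d.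
  by move=> cA dA; rewrite (hB _ cA) (hB _ dA) ltnS ltn_add2l.
by apply: g_minor; rewrite ?in_setC //; apply: lt_g.
Qed.

(** * Pendant vertices and parts hanging at a vertex *)

Definition leaf_at q v := forall z, G q z = (z == v).

Lemma leaf_at_pendant p v : pendant G p -> G p v -> leaf_at p v.
Proof.
rewrite /pendant => /cards1P[w nbr_p] pv z.
have nbrE u : G p u = (u == w) by have := in_set1 u w; rewrite -nbr_p inE.
by rewrite nbrE; move: pv; rewrite nbrE => /eqP ->.
Qed.

Lemma leaf_at_sees S q v : leaf_at q v -> sees_only G S q v.
Proof. by move=> q_v z _. Qed.

(** In a layout without [q], the pendant [p] keeps edges from passing over [v], so [q] can be put
    back next to [v]. *)
Lemma leaf_unique p q v : leaf_at p v -> leaf_at q v -> p = q.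
Proof.
move=> p_v q_v; apply/eqP/negPn/negP => npq; apply: critG.1.
have [f layf] := critG.2 [::] q.
have qv : v != q by apply: contraFneq (adj_irr G q) => vq; rewrite q_v vq.
rewrite -(_ : q |: [set~ q] = setT); last by rewrite setUCr.
apply: (@add_pendant _ _ _ f q v layf); rewrite ?inE ?eqxx //.
  by apply: (pendant_split layf _ _ (leaf_at_sees p_v)); rewrite !inE.
Qed.

(** A part that can be laid out entirely on one side of [v]; two such parts can be glued at [v]. *)
Definition ends v (X : {set V}) :=
  exists2 f, layout G (v |: X) f & {in X, forall a, f a < f v}.

Lemma ends_rev v X : ends v X -> exists2 f, layout G (v |: X) f & {in X, forall a, f v < f a}.
Proof.
case=> f layf fX; have [g layg gE] := layout_rev layf.
by exists g => // a aX; rewrite gE fX.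
Qed.

(** One leg of a subdivided claw centred at [v], except that [b] may also be adjacent to [v]. *)
Definition branch v (X : {set V}) := exists a b, [/\ a \in X, b \in X, G v a & G a b].

(** Without a branch, no neighbour of [v] in [X] has a neighbour in [X]; by connectivity every
    vertex of [X] is then adjacent to [v] and to nothing else. *)
Lemma leaves_or_branch v (X : {set V}) :
  v \notin X -> {in X, forall x z, G x z -> z \in v |: X} ->
  {in X, forall x, leaf_at x v} \/ branch v X.
Proof.
move=> vX closedX.
have [/existsP[a /existsP[b /and4P[aX bX va ab]]]|/existsPn noB] :=
  boolP [exists a, exists b, [&& a \in X, b \in X, G v a & G a b]].
  by right; exists a, b.
left=> x xX.
have {}noB a b : a \in X -> b \in X -> G v a -> G a b = false.
  by move=> aX bX va; have /existsPn/(_ b) := noB a; rewrite aX bX va => /negPf.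
have vx : G v x.
  apply: contraNT vX => nvx.
  have := critical_connect x v.
  move/(@connect_ind _ _ [pred z | (z \in X) && ~~ G v z]) => ind.
  suff /andP[//] : v \in [pred z | (z \in X) && ~~ G v z].
  apply: ind => [c d|]; rewrite !inE ?xX //= => /andP[cX nvc] cd.
  have /setU1P[dv|dX] := closedX c cX d cd; first by rewrite dv adj_sym in cd; rewrite cd in nvc.
  by rewrite dX; apply: contraL cd => vd; rewrite adj_sym noB.
move=> z; have [->|nzv] := eqVneq z v; first by rewrite adj_sym.
apply/negP => xz; have /setU1P[/eqP|zX] := closedX x xX z xz; first by rewrite (negPf nzv).
by rewrite noB in xz.
Qed.

(** Complementing at [v] turns [a1], [a2], [a3] into a triangle, and the three pairs of an [a] and
    its [b] then exclude a layout even without [v]. Edges among the [b] vertices and from them to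
    [v] are arbitrary. *)
Lemma three_branches v a1 b1 a2 b2 a3 b3 :
    [/\ G v a1, G v a2 & G v a3] -> [/\ G a1 b1, G a2 b2 & G a3 b3] ->
    [/\ ~~ G a1 a2, ~~ G a1 a3 & ~~ G a2 a3] ->
    [/\ ~~ G a1 b2, ~~ G a1 b3 & ~~ G a2 b3] ->
    [/\ ~~ G a2 b1, ~~ G a3 b1 & ~~ G a3 b2] -> False.
Proof.
move=> [va1 va2 va3] [ab1 ab2 ab3] [a12 a13 a23] [ab12 ab13 ab23] [ab21 ab31 ab32].
have ne x y z : G x y -> ~~ G x z -> y != z by move=> xy; apply: contraNneq => <-.
have a21 : ~~ G a2 a1 by rewrite adj_sym.
have a31 : ~~ G a3 a1 by rewrite adj_sym.
have a32 : ~~ G a3 a2 by rewrite adj_sym.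
pose M := local_complement G v.
have ME x y : M x y = G x y (+) [&& x != y, G v x & G v y] by rewrite /= /lc_adj !inE.
have nv x : G v x -> x \in [set~ v].
  by move=> vx; rewrite !inE; apply: contraTneq vx => ->; rewrite adj_irr.
have nbv a b : G v a -> ~~ G a b -> b \in [set~ v].
  by move=> va nab; rewrite !inE; apply: contraNneq nab => ->; rewrite adj_sym.
have neab a b : G a b -> a != b by apply: contraTneq => ->; rewrite adj_irr.
(* In [M] the vertices [a], [c], [d] are mutually adjacent, while at [b] the vertex [a] differs from
   both [c] and [d]; a cut splitting [a] from [b] and [c] from [d] therefore has a nonzero minor. *)
have sep a b c d : G v a -> G v c -> G v d -> G a b -> ~~ G a c -> ~~ G a d -> ~~ G c d ->
    ~~ G c b -> ~~ G d b -> a != c -> a != d -> c != d -> separates M [set~ v] a b c d.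
  move=> va vc vd ab nac nad ncd ncb ndb ac ad cd.
  have aS := nv a va; have cS := nv c vc; have dS := nv d vd; have bS := nbv c b vc ncb.
  have Mab : M a b = ~~ G v b by rewrite ME ab va neab.
  have Mcb : M c b = G v b.
    by rewrite ME (negPf ncb) vc; have := ne a b c ab nac; rewrite eq_sym => ->.
  have Mdb : M d b = G v b.
    by rewrite ME (negPf ndb) vd; have := ne a b d ab nad; rewrite eq_sym => ->.
  have Mac : M a c by rewrite ME (negPf nac) ac va vc.
  have Mad : M a d by rewrite ME (negPf nad) ad va vd.
  have Mcd : M c d by rewrite ME (negPf ncd) cd vd vc.
  apply: separatesI => A flatA aA bA.
  have [cA|cA] := boolP (c \in A); have [dA|dA] := boolP (d \in A) => //.
    have := flatA a c b d aS cS bS dS aA cA bA dA.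
    by rewrite Mab Mcd Mad Mcb; case: (G v b).
  have := flatA a d b c aS dS bS cS aA dA bA cA.
  by rewrite Mab (adj_sym M d c) Mcd Mac Mdb; case: (G v b).
have n12 : a1 != a2 by rewrite eq_sym; apply: contraNneq ab21 => ->.
have n13 : a1 != a3 by rewrite eq_sym; apply: contraNneq ab31 => ->.
have n23 : a2 != a3 by rewrite eq_sym; apply: contraNneq ab32 => ->.
have := critG.2 [:: v] v; apply: (@not_linearizable_three _ M _ a1 b1 a2 b2 a3 b3).
- by split; apply: nv.
- by split; [apply: (nbv a2) | apply: (nbv a1) | apply: (nbv a1)].
- by split.
- by split; apply: neab.
- exact: sep.
- by apply: sep; rewrite // eq_sym.
by apply: sep; rewrite // eq_sym.
Qed.

(** The parts are glued at [v]. At most one vertex remains, since two pendant vertices cannot share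
    [v], and it is inserted next to [v], which would lay out [G]. *)
Lemma two_ends v X Z : ends v X -> ends v Z -> v \notin X -> v \notin Z ->
  [disjoint X & Z] -> {in X & Z, forall x z, ~~ G x z} ->
  (forall q, q \notin v |: (X :|: Z) -> leaf_at q v) -> False.
Proof.
move=> [f layf fX] /ends_rev[g layg gZ] vX vZ dXZ nXZ leaves.
have [h layh [hX hZ]] := layout_cat layf fX layg gZ dXZ nXZ.
have [full|] := eqVneq (v |: (X :|: Z)) setT.
  by apply: critG.1; exists h; rewrite -full.
case/eqP/setP; apply/subset_eqP; rewrite subsetT /=.
apply/subsetP => q _; apply/negPn/negP => qS; apply: critG.1.
rewrite -(_ : q |: (v |: (X :|: Z)) = setT).
  apply: (add_pendant layh (setU11 _ _) qS); last exact/leaf_at_sees/leaves.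
  have side x : x \in v |: (X :|: Z) -> [\/ x = v, x \in X | x \in Z].
    by rewrite !inE => /or3P[/eqP ->|->|->]; [constructor 1|constructor 2|constructor 3].
  move=> a b /side[->|aX|aZ] /side[->|bX|bZ]; rewrite ?ltnn // => av vb.
  - by have := hX b bX; rewrite ltnNge (ltnW vb).
  - exact: nXZ.
  - by have := hX b bX; rewrite ltnNge (ltnW vb).
  by have := hZ a aZ; rewrite ltnNge (ltnW av).
apply/setP => r; rewrite in_setT in_setU1; have [//|/leaves r_v] := boolP (r \in _ |: _).
  by rewrite orbT.
by rewrite (leaf_unique r_v (leaves q qS)) eqxx.
Qed.

End Critical.

(** * Cut vertices *)

Section CutVertex.
Variables (V : finType) (G : sgraph V).
Hypothesis critG : critical G.

(* The pendant vertex [b] forces every layout to split [A] into a part before [v]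
   and a part after it, without edges between them. *)
Lemma split_side v b b' (A : {set V}) :
    v \notin A -> b' \notin b |: (v |: A) -> G b v -> {in A, forall a, ~~ G b a} ->
  exists X Y, [/\ X :|: Y = A, [disjoint X & Y], {in X & Y, forall x y, ~~ G x y},
    ends G v X & ends G v Y].
Proof.
move=> vA b'S bv bA.
have [f layf] := critical_sub critG b'S.
have nbv : b != v by apply: contraTneq bv => ->; rewrite adj_irr.
have b_v : sees_only G (b |: (v |: A)) b v.
  move=> z; rewrite !inE => /or3P[/eqP->|/eqP->|zA].
  - by rewrite adj_irr (negPf nbv).
  - by rewrite eqxx.
  by rewrite (negPf (bA z zA)); apply/esym/negbTE; apply: contraNneq vA => <-.
have bS := setU11 b (v |: A).
have vS : v \in b |: (v |: A) by rewrite !inE eqxx orbT.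
have AS a : a \in A -> a \in b |: (v |: A) by move=> aA; rewrite !inE aA !orbT.
have split_v := pendant_split layf bS vS b_v.
have subS (P : pred V) : v |: [set a in A | P a] \subset b |: (v |: A).
  by apply/subsetP => x; rewrite !inE => /orP[->|/andP[-> _]]; rewrite ?orbT.
exists [set a in A | f a < f v], [set a in A | f v < f a]; split.
- apply/setP => a; rewrite !inE -andb_orr -neq_ltn; apply/andb_idr => aA.
  by apply: contraNneq vA => /(layf.1 _ _ (AS a aA) vS) <-.
- by apply/pred0P => a; rewrite !inE /=; apply/negP => /andP[/andP[_ ?] /andP[_ ?]]; lia.
- by move=> x y; rewrite !inE => /andP[xA xv] /andP[yA vy]; apply: split_v; rewrite ?AS.
- by exists f; [apply: layout_sub layf; apply: subS | move=> a; rewrite inE => /andP[]].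
have [g layg gE] := layout_rev layf.
exists g; first by apply: layout_sub layg; apply: subS.
by move=> a; rewrite inE gE => /andP[].
Qed.

(** One of the two parts from [split_side] has a branch: otherwise [A] would consist of at least two
    pendant vertices at [v]. The branching part is called [X]. *)
Lemma branching_side v b b' (A : {set V}) :
    v \notin A -> b' \notin b |: (v |: A) -> G b v -> {in A, forall a, ~~ G b a} ->
    1 < #|A| -> {in A, forall x z, G x z -> z \in v |: A} ->
  exists X Y, [/\ X :|: Y = A, {in X & Y, forall x y, ~~ G x y}, ends G v X, branch G v X
    & {in Y, forall x, leaf_at G x v} \/ branch G v Y].
Proof.
move=> vA b'S bv bA A2 closedA.
have [X [Y [XYA dXY nXY endX endY]]] := split_side vA b'S bv bA.
have [XA YA] : X \subset A /\ Y \subset A by rewrite -XYA subsetUl subsetUr.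
have vX : v \notin X by apply: contra vA; apply: (subsetP XA).
have vY : v \notin Y by apply: contra vA; apply: (subsetP YA).
have closedX : {in X, forall x z, G x z -> z \in v |: X}.
  move=> x xX z xz; have := closedA x (subsetP XA x xX) z xz.
  rewrite -XYA !inE => /or3P[->|->|zY]; rewrite ?orbT //.
  by rewrite (negPf (nXY x z xX zY)) in xz.
have closedY : {in Y, forall x z, G x z -> z \in v |: Y}.
  move=> x xY z xz; have := closedA x (subsetP YA x xY) z xz.
  rewrite -XYA !inE => /or3P[->|zX|->]; rewrite ?orbT //.
  by rewrite adj_sym (negPf (nXY z x zX xY)) in xz.
have [leafX|brX] := leaves_or_branch critG vX closedX;
  have [leafY|brY] := leaves_or_branch critG vY closedY.
- have leafA : {in A, forall x, leaf_at G x v}.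
    by move=> x; rewrite -XYA inE => /orP[/leafX|/leafY].
  have /card_gt1P[x [y [xA yA]]] := A2.
  by rewrite (leaf_unique critG (leafA x xA) (leafA y yA)) eqxx.
- exists Y, X; split=> //; [by rewrite setUC | | by left].
  by move=> x y xY yX; rewrite adj_sym nXY.
- by exists X, Y; split=> //; left.
by exists X, Y; split=> //; right.
Qed.

Lemma branches_apart v X Y Z : branch G v X -> branch G v Y -> branch G v Z ->
  {in X & Y, forall x y, ~~ G x y} -> {in X & Z, forall x y, ~~ G x y} ->
  {in Y & Z, forall x y, ~~ G x y} -> False.
Proof.
move=> [a1 [b1 [a1X b1X va1 ab1]]] [a2 [b2 [a2Y b2Y va2 ab2]]] [a3 [b3 [a3Z b3Z va3 ab3]]].
move=> nXY nXZ nYZ.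
apply: (three_branches critG (v := v) (a1 := a1) (b1 := b1) (a2 := a2) (b2 := b2)
  (a3 := a3) (b3 := b3)); split=> //;
  first [exact: nXY | exact: nXZ | exact: nYZ
     | rewrite adj_sym; first [exact: nXY | exact: nXZ | exact: nYZ]].
Qed.

(** Each side has a branching part ending at [v]. A third branch is impossible, so the remainders
    are pendant vertices at [v], and gluing the two branching parts contradicts [two_ends]. *)
Lemma no_big_cut v (A B : {set V}) :
    v \notin A -> v \notin B -> v |: (A :|: B) = setT -> [disjoint A & B] ->
    {in A & B, forall a b, ~~ G a b} -> 1 < #|A| -> 1 < #|B| -> False.
Proof.
move=> vA vB ABV dAB nAB A2 B2.
have closed (P Q : {set V}) : v |: (P :|: Q) = setT -> {in P & Q, forall a b, ~~ G a b} ->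
    {in P, forall x z, G x z -> z \in v |: P}.
  move=> PQV nPQ x xP z xz; have := in_setT z; rewrite -PQV !inE orbA => /orP[//|zQ].
  by rewrite (negPf (nPQ x z xP zQ)) in xz.
have side (P Q : {set V}) : v \notin P -> v \notin Q -> v |: (P :|: Q) = setT ->
    [disjoint P & Q] -> {in P & Q, forall a b, ~~ G a b} -> 1 < #|P| -> 1 < #|Q| ->
  exists X Y, [/\ X :|: Y = P, {in X & Y, forall x y, ~~ G x y}, ends G v X, branch G v X
    & {in Y, forall x, leaf_at G x v} \/ branch G v Y].
  move=> vP vQ PQV dPQ nPQ P2 Q2.
  have nQP : {in Q & P, forall a b, ~~ G a b} by move=> x y xQ yP; rewrite adj_sym nPQ.
  have QPV : v |: (Q :|: P) = setT by rewrite [Q :|: P]setUC.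
  have /card_gt0P[q qQ] : 0 < #|Q| by apply: ltnW.
  (* [b] is a neighbour of [v] in [Q] and acts as a pendant vertex when only [P] is kept; a second
     vertex [b'] of [Q] is the one left out. *)
  have [b [c [bc bQ cQ _ _]]] := connect_cross (critical_connect critG q v) qQ vQ.
  have bv : G b v.
    by have := closed Q P QPV nQP b bQ c bc; rewrite !inE (negPf cQ) orbF => /eqP <-.
  have /card_gt1P[d [d' [dQ d'Q dd']]] := Q2.
  have [b' b'Q nb'b] : exists2 b', b' \in Q & b' != b.
    by have [<-|] := eqVneq d b; [exists d'; rewrite // eq_sym | exists d].
  apply: (@branching_side v b b' P) => //; last exact: closed nPQ.
    rewrite !inE !negb_or nb'b (disjointFl dPQ) // andbT.
    by apply: contraNneq vQ => <-.
  by move=> a aP; apply: nQP.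
have BAV : v |: (B :|: A) = setT by rewrite [B :|: A]setUC.
have dBA : [disjoint B & A] by rewrite disjoint_sym.
have nBA : {in B & A, forall a b, ~~ G a b} by move=> x y xB yA; rewrite adj_sym nAB.
have [X [Y [XYA nXY endX brX trivY]]] := side A B vA vB ABV dAB nAB A2 B2.
have [Z [W [ZWB nZW endZ brZ trivW]]] := side B A vB vA BAV dBA nBA B2 A2.
have [XA YA] : X \subset A /\ Y \subset A by rewrite -XYA subsetUl subsetUr.
have [ZB WB] : Z \subset B /\ W \subset B by rewrite -ZWB subsetUl subsetUr.
have apart (P Q : {set V}) : P \subset A -> Q \subset B -> {in P & Q, forall x y, ~~ G x y}.
  by move=> /subsetP PA /subsetP QB x y /PA xA /QB yB; apply: nAB.
have {trivY}leafY : {in Y, forall x, leaf_at G x v}.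
  by case: trivY => // brY; case: (branches_apart brX brY brZ nXY); apply: apart.
have {trivW}leafW : {in W, forall x, leaf_at G x v}.
  by case: trivW => // brW; case: (branches_apart brX brZ brW) => //; apply: apart.
apply: (two_ends critG endX endZ).
- by apply: contra vA; apply: (subsetP XA).
- by apply: contra vB; apply: (subsetP ZB).
- exact: disjointWl XA (disjointWr ZB dAB).
- exact: apart.
move=> q; rewrite !inE !negb_or => /and3P[qv qX qZ].
have := in_setT q; rewrite -ABV -XYA -ZWB !inE (negPf qv) (negPf qX) (negPf qZ) /=.
by case/orP => [/leafY|/leafW].
Qed.

(** * The core left by the pendant vertices *)

Definition core := [set x | ~~ pendant G x].

Lemma critical_degree x : 0 < degree G x.
Proof.
rewrite card_gt0; apply/eqP => nbr0.
have nx z : G x z = false by rewrite -[LHS](in_set (G x)) -[[set _ | _]]/(nbr G x) nbr0 inE.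
have eqx z : z = x.
  apply/eqP; rewrite -[_ == _]/(z \in pred1 x).
  by apply: connect_ind (critical_connect critG x z) _; [move=> a b /eqP->; rewrite nx | exact: eqxx].
have := critical_card critG; rewrite ltnNge; case/negP; apply: leq_trans (leqnSn _).
by apply/fintype_le1P => z u; rewrite (eqx z) (eqx u).
Qed.

Lemma core_nbr x w : x \in core -> exists2 z, G x z & z != w.
Proof.
rewrite inE /pendant => px.
have : 1 < degree G x by have := critical_degree x; lia.
case/card_gt1P => z [u [zx ux zu]]; rewrite !inE in zx ux.
by have [<-|] := eqVneq z w; [exists u; rewrite // eq_sym | exists z].
Qed.

(** An empty [T] gives connectivity, a singleton 2-connectivity. If the vertex of [T] cut the core,
    both sides of the cut in [G] would have at least two vertices because core vertices have degree
    at least 2, against [no_big_cut]. *)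
Lemma core_connected (T : {set V}) x y : #|T| <= 1 -> x \in core :\: T -> y \in core :\: T ->
  connect (within G (core :\: T)) x y.
Proof.
move=> T1 xR yR; apply/negPn/negP => nxy.
pose K := [set z | connect (within G (core :\: T)) x z].
(* The component [K] of [x] with the pendant vertices hanging on it, so that edges leave [A] only
   into [T]. *)
pose A := [set z | (z \notin T) && ((z \in K) || pendant G z && [exists k in K, G z k])].
have KR z : z \in K -> z \in core :\: T.
  rewrite inE; have [<-//|nxz] := eqVneq x z.
  move/(@connect_ind _ _ [pred z | z \in core :\: T]); apply=> //= a b _.
  by case/and3P.
have coreA z : z \in core -> z \in A -> z \in K.
  by rewrite !inE => pz /andP[_ /orP[//|/andP[pz']]]; rewrite pz' in pz.
have closedA a z : a \in A -> G a z -> z \notin T -> z \in A.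
  rewrite inE => /andP[aT /orP[aK|/andP[pa /existsP[k /andP[kK ak]]]]] az zT.
    rewrite inE zT /=; have [pz|pz] := boolP (pendant G z).
      by apply/orP; right; apply/existsP; exists a; rewrite aK adj_sym.
    rewrite orbF inE; move: (aK); rewrite inE => /connect_trans; apply; apply: connect1.
    by rewrite /within KR // az andbT !inE zT.
  have := leaf_at_pendant pa ak z; rewrite az => /esym/eqP->.
  by rewrite inE kK andbT; have := KR k kK; rewrite inE => /andP[].
have xA : x \in A by move: xR; rewrite !inE connect0 => /andP[->].
have [xT xc] : x \notin T /\ x \in core by apply/andP; rewrite -in_setD.
have [yT yc] : y \notin T /\ y \in core by apply/andP; rewrite -in_setD.
have yA : y \notin A by apply/negP => /(coreA _ yc); rewrite inE (negPf nxy).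
have [T0|/card_gt0P[w wT]] := posnP #|T|.
  have nT z : z \notin T by rewrite (cards0_eq T0) inE.
  have [a [b [ab aA bA _ _]]] := connect_cross (critical_connect critG x y) xA yA.
  by rewrite (closedA a b aA ab (nT b)) in bA.
have TE : T = [set w].
  by apply/esym/eqP; rewrite eqEcard sub1set wT cards1.
have inT z : (z \in T) = (z == w) by rewrite TE inE.
have sep : {in A & ~: (w |: A), forall a b, ~~ G a b}.
  move=> a b aA; rewrite in_setC in_setU1 negb_or => /andP[bw bA].
  by apply: contra bA => ab; apply: closedA aA ab _; rewrite inT.
apply: (@no_big_cut w A (~: (w |: A))).
- by rewrite inE wT.
- by rewrite !inE eqxx.
- by rewrite setUA setUCr.
- by rewrite disjoints_subset setCK subsetUr.
- exact: sep.
- have [z xz zw] := core_nbr w xc; apply/card_gt1P; exists x, z; split=> //.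
    by apply: closedA xz _; rewrite // inT.
  by apply: contraTneq xz => ->; rewrite adj_irr.
have [z yz zw] := core_nbr w yc.
have yB : y \in ~: (w |: A) by rewrite in_setC in_setU1 negb_or yA andbT -inT.
apply/card_gt1P; exists y, z; split=> //.
  rewrite in_setC in_setU1 negb_or zw /=; apply: contraL yz => zA.
  by rewrite adj_sym sep.
by apply: contraTneq yz => ->; rewrite adj_irr.
Qed.

End CutVertex.

(** * Three pendant vertices *)

Section ThreePendants.
Variables (V : finType) (G : sgraph V).
Hypothesis critG : critical G.
Notation core := (core G).

Definition three_leaves x1 y1 x2 y2 x3 y3 :=
  [/\ [/\ leaf_at G y1 x1, leaf_at G y2 x2 & leaf_at G y3 x3],
      [/\ x1 \in core, x2 \in core & x3 \in core] &
      [/\ x1 != x2, x1 != x3 & x2 != x3]].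

Lemma leaf_at_core y x : leaf_at G y x -> y \notin core.
Proof.
move=> y_x; rewrite inE negbK; apply/eqP; rewrite /degree -(cards1 x); congr #|pred_of_set _|.
by apply/setP => z; rewrite !inE y_x.
Qed.

Lemma core_connected1 u x y : x \in core -> y \in core -> x != u -> y != u ->
  connect (within G (core :\: [set u])) x y.
Proof.
move=> xc yc xu yu; apply: core_connected; rewrite ?cards1 //;
  by rewrite in_setD inE ?xu ?yu.
Qed.

(** A further pendant vertex could be deleted without creating a layout: the core without any one of
    [x1], [x2], [x3] still connects the other two. *)
Lemma three_leaves_all x1 y1 x2 y2 x3 y3 w : three_leaves x1 y1 x2 y2 x3 y3 ->
  w \notin core -> [|| w == y1, w == y2 | w == y3].
Proof.
move=> [[l1 l2 l3] [x1c x2c x3c] [n12 n13 n23]] wc; apply: contraT.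
rewrite !negb_or => /and3P[w1 w2 w3].
have coreS z : z \in core -> z \in [set~ w].
  by move=> zc; rewrite !inE; apply: contraNneq wc => <-.
have leafS y : w != y -> y \in [set~ w] by rewrite !inE eq_sym.
have ne x y : x \in core -> leaf_at G y x -> x != y.
  by move=> xc /leaf_at_core; apply: contraNneq => <-.
have sep x y r s : x \in core -> w != y -> leaf_at G y x -> r \in core -> s \in core ->
    r != x -> s != x -> separates G [set~ w] x y r s.
  move=> xc wy y_x rc sc rx sx.
  apply: (@pendant_separates _ _ _ (core :\: [set x])).
  - exact: coreS.
  - exact: leafS.
  - exact: leaf_at_sees.
  - by apply/subsetP => z; rewrite in_setD => /andP[_]; apply: coreS.
  - by rewrite !inE eqxx.
  exact: core_connected1.
case: (@not_linearizable_three _ G [set~ w] x1 y1 x2 y2 x3 y3); last exact: (critG.2 [::] w).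
- by split; apply: coreS.
- by split; apply: leafS.
- by split.
- by split; apply: ne.
- by apply: sep; rewrite // eq_sym.
- by apply: sep; rewrite // eq_sym.
by apply: sep.
Qed.

(** * Deleting a twin after local complementation *)

Section TwinMinor.
Variables (x1 y1 x2 y2 x3 y3 t : V) (M : sgraph V).
Hypothesis leaves : three_leaves x1 y1 x2 y2 x3 y3.
Hypothesis t_core : t \in core.
Hypothesis t_ne : [/\ t != x1, t != x2 & t != x3].
Let D := core :\: [set x1; t].
Hypothesis apart : ~~ connect (within G D) x2 x3.
Hypothesis M_D : {in D &, forall z z', M z z' = G z z' (+) [&& z != z', G t z & G t z']}.
Hypothesis M_x1 : {in D, forall z, M x1 z = G t z}.
Hypothesis M_y2 : sees_only M [set~ t] y2 x2.
Hypothesis M_y3 : sees_only M [set~ t] y3 x3.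
Hypothesis M_y1 : sees_only M [set~ t] y1 x1 \/
  {in [set~ t], forall z, M y1 z = (z \in D) && G t z}.

(* The edges inside [D] kept by the complementation of [N(t)]. *)
Let e0 : rel V := fun u v => [&& u \in D, v \in D, G u v & ~~ (G t u && G t v)].

(** The hypotheses on [M] cover two graphs at once: complementing at [t], where [y1] stays pendant,
    and complementing at [x1] and then [t], where [y1] sees the same part of [D] as [x1]. In both,
    the components of [x2] and [x3] become joined through the neighbours of [t]. *)
Lemma twin_minor_not_linearizable : ~ linearizable M [set~ t].
Proof.
have [[l1 l2 l3] [x1c x2c x3c] [n12 n13 n23]] := leaves; have [t1 t2 t3] := t_ne.
have DE z : (z \in D) = [&& z != x1, z != t & z \in core] by rewrite !inE negb_or andbA.
have x2D : x2 \in D by rewrite DE eq_sym n12 eq_sym t2.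
have x3D : x3 \in D by rewrite DE eq_sym n13 eq_sym t3.
have DR z : z \in D -> z \in [set~ t] by rewrite DE in_setC1 => /and3P[].
have x1R : x1 \in [set~ t] by rewrite in_setC1 eq_sym.
have yR y x : leaf_at G y x -> y \in [set~ t].
  by move=> /leaf_at_core yc; rewrite in_setC1; apply: contraNneq yc => ->.
have e0_sym : connect_sym e0.
  by apply: sym_connect_sym => u v; rewrite /e0 adj_sym andbCA [G t u && _]andbC.
have GD_sym := sym_connect_sym (@within_sym _ G D).
have MD_sym A := sym_connect_sym (@within_sym _ M A).
have e0_G u v : connect e0 u v -> connect (within G D) u v.
  by apply: connect_sub => a b /and4P[aD bD ab _]; apply: connect1; rewrite /within aD bD.
have e0_M u v : e0 u v -> M u v.
  by case/and4P => uD vD uv nuv; rewrite M_D // uv (negPf nuv) andbF.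
(* The core without [x1] is connected, so a path leads from [z] to [t]; up to its first neighbour of
   [t] it uses only edges of [e0]. *)
have toN z : z \in D -> exists n, [/\ n \in D, G t n & connect e0 z n].
  move=> zD; have [/existsP[n /and3P[]]|/existsPn noN] :=
    boolP [exists n, [&& n \in D, G t n & connect e0 z n]]; first by exists n.
  have := zD; rewrite DE => /and3P[zx1 zt zc].
  have zt_conn : connect (within G (core :\: [set x1])) z t by apply: core_connected1.
  suff : t \in [pred u | (u \in D) && connect e0 z u] by rewrite inE DE eqxx andbF.
  apply: connect_ind zt_conn _; last by rewrite inE zD connect0.
  move=> a b /andP[aD za] /and3P[_ bD' ab].
  have nta : G t a = false by have := noN a; rewrite aD za andbT => /negPf.
  have bt : b != t by apply: contraTneq ab => ->; rewrite adj_sym nta.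
  have bD : b \in D by move: bD'; rewrite DE bt !inE.
  rewrite inE bD; apply: connect_trans za (connect1 _).
  by rewrite /e0 aD bD ab nta.
have [n2 [n2D tn2 xn2]] := toN x2 x2D; have [n3 [n3D tn3 xn3]] := toN x3 x3D.
have far u v : connect (within G D) x2 u -> connect (within G D) x3 v -> u \in D -> v \in D ->
    G u v = false.
  move=> xu xv uD vD; apply: contraNF apart => uv.
  apply: connect_trans xu _; apply: connect_trans (connect1 _) _; last by rewrite GD_sym; exact: xv.
  by rewrite /within uD vD.
have n23' : n2 != n3.
  apply: contraNneq apart => n23'; apply: connect_trans (e0_G _ _ xn2) _.
  by rewrite n23' GD_sym e0_G.
(* Two neighbours of [t] in different components are non-adjacent in [G], hence adjacent after
   complementation. *)
have Mn23 : M n2 n3 by rewrite M_D // (far n2 n3) ?e0_G // n23' tn2 tn3.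
have e0_MD u v : connect e0 u v -> connect (within M D) u v.
  by apply: connect_sub => a b ab; apply: connect1; rewrite /within e0_M //; case/and4P: ab => -> ->.
have M23 : connect (within M D) x2 x3.
  apply: connect_trans (e0_MD _ _ xn2) _; apply: connect_trans (connect1 _) _; last first.
    by rewrite MD_sym; apply: e0_MD xn3.
  by rewrite /within n2D n3D.
(* Since [x1] sees the neighbours of [t], it is linked to [x] within the component of [x] alone,
   avoiding the other component. *)
have hub x n : x \in D -> n \in D -> G t n -> connect e0 x n ->
    connect (within M (x1 |: [set u in D | connect (within G D) x u])) x1 x.
  move=> xD nD tn xn; set A := x1 |: _.
  have AP u : u \in D -> connect (within G D) x u -> u \in A.
    by move=> uD xu; rewrite in_setU1 inE uD xu orbT.
  have nA : n \in A by apply: AP => //; apply: e0_G.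
  apply: connect_trans (connect1 (_ : within M A x1 n)) _.
    by rewrite /within setU11 nA M_x1.
  rewrite MD_sym.
  suff /andP[_ //] : n \in [pred u | connect (within G D) x u && connect (within M A) x u].
  apply: connect_ind xn _; last by rewrite inE !connect0.
  move=> a b /andP[xa xa'] ab; have /and4P[aD bD Gab _] := ab.
  have xb : connect (within G D) x b.
    by apply: connect_trans xa (connect1 _); rewrite /within aD bD.
  by rewrite inE xb; apply: connect_trans xa' (connect1 _); rewrite /within !AP // e0_M.
have apart' : ~~ connect (within G D) x3 x2 by rewrite GD_sym.
have sep_leaf x y z n : x \in D -> leaf_at G y x -> sees_only M [set~ t] y x ->
    ~~ connect (within G D) z x -> z \in D -> n \in D -> G t n -> connect e0 z n ->
    separates M [set~ t] x y x1 z.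
  move=> xD yx y_x nzx zD nD tn zn.
  apply: (pendant_separates _ _ y_x _ _ (hub z n zD nD tn zn)).
  - exact: DR.
  - exact: yR yx.
  - by apply/subsetP => u; rewrite in_setU1 => /orP[/eqP->//|]; rewrite inE => /andP[/DR].
  by rewrite in_setU1 inE (negPf nzx) andbF orbF; move: xD; rewrite DE => /and3P[].
have ne x y : x \in core -> leaf_at G y x -> x != y.
  by move=> xc /leaf_at_core; apply: contraNneq => <-.
apply: (@not_linearizable_three _ M _ x1 y1 x2 y2 x3 y3).
- by split=> //; apply: DR.
- by split; [apply: yR l1 | apply: yR l2 | apply: yR l3].
- by split.
- by split; apply: ne.
- case: M_y1 => [y1_x1|M_y1'].
    apply: (pendant_separates x1R (yR _ _ l1) y1_x1 _ _ M23).
      by apply/subsetP => z; apply: DR.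
    by rewrite DE eqxx.
  have My1 n : n \in D -> M n y1 = G t n by move=> nD; rewrite adj_sym M_y1' ?DR // nD.
  have Mx1y1 : M x1 y1 = false by rewrite adj_sym M_y1' // DE eqxx.
  apply: separatesI => A flatA x1A y1A.
  (* [x1] and [y1] are non-adjacent and both see all neighbours of [t] in [D], so a flat cut between
     them cannot split these neighbours. *)
  have noN n n' : n \in D -> n' \in D -> G t n -> G t n' -> n \in A -> n' \notin A -> False.
    move=> nD n'D tn tn' nA n'A.
    have := flatA x1 n y1 n' x1R (DR n nD) (yR _ _ l1) (DR n' n'D) x1A nA y1A n'A.
    by rewrite Mx1y1 M_x1 // My1 // tn tn'.
  (* With the neighbours of [t] on one side, an edge of [e0] crosses the cut in the component of [s]
     or of [r]. Paired with [nr y1] or with [x1 ns] respectively, it gives a nonzero minor. *)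
  have one_side r s nr ns : nr \in D -> ns \in D -> G t nr -> G t ns ->
      connect e0 r nr -> connect e0 s ns ->
      (forall u v, connect (within G D) r u -> connect (within G D) s v ->
         u \in D -> v \in D -> G u v = false) ->
      r \in A -> s \notin A -> False.
    move=> nrD nsD tnr tns rnr sns far_rs rA sA.
    have [nrA|nrA] := boolP (nr \in A).
      have nsA : ns \in A by apply/negPn/negP => /(noN nr ns nrD nsD tnr tns nrA).
      have ns_s : connect e0 ns s by rewrite e0_sym.
      have [a [b [ab aA bA nsa nsb]]] := connect_cross ns_s nsA sA.
      have /and4P[aD bD Gab _] := ab.
      have tb : G t b = false by apply/negP => tb; apply: (noN nr b).
      have sb : connect (within G D) s b by apply: e0_G; apply: connect_trans sns nsb.
      have := flatA a nr b y1 (DR a aD) (DR nr nrD) (DR b bD) (yR _ _ l1) aA nrA bA y1A.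
      by rewrite e0_M // My1 // tnr (M_D nrD bD) (far_rs nr b (e0_G _ _ rnr) sb nrD bD) tb !andbF.
    have nsA : ns \notin A by apply/negP => nsA; apply: (noN ns nr).
    have [a [b [ab aA bA ra rb]]] := connect_cross rnr rA nrA.
    have /and4P[aD bD Gab _] := ab.
    have ta : G t a = false by apply/negP => ta; apply: (noN a ns).
    have := flatA a x1 b ns (DR a aD) x1R (DR b bD) (DR ns nsD) aA x1A bA nsA.
    by rewrite e0_M // M_x1 // tns (M_D aD nsD) (far_rs a ns (e0_G _ _ ra) (e0_G _ _ sns) aD nsD) ta andbF.
  have [x2A|x2A] := boolP (x2 \in A); have [x3A|x3A] := boolP (x3 \in A) => //.
    by case: (one_side x2 x3 n2 n3).
  case: (one_side x3 x2 n3 n2) => // u v xu xv uD vD.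
  by rewrite adj_sym far.
- exact: (sep_leaf x2 y2 x3 n3).
exact: (sep_leaf x3 y3 x2 n2).
Qed.

End TwinMinor.
End ThreePendants.

(** * Twins in the core *)

Section Twins.
Variables (V : finType) (G : sgraph V).
Hypothesis critG : critical G.
Notation core := (core G).

(** If [x2] and [x3] are connected in the core without [x1] and [t], deleting [t] from [G] leaves no
    layout. Otherwise [t] is deleted after complementing at [t], preceded by [x1] if the twins are
    adjacent, and the previous section applies. *)
Lemma no_core_twin x1 y1 x2 y2 x3 y3 t : three_leaves G x1 y1 x2 y2 x3 y3 ->
  t \in core -> [/\ t != x1, t != x2 & t != x3] ->
  (forall z, z \in core -> z != x1 -> z != t -> G t z = G x1 z) -> False.
Proof.
move=> leaves tc t_ne twin.
have [[l1 l2 l3] [x1c x2c x3c] [n12 n13 n23]] := leaves; have [t1 t2 t3] := t_ne.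
set D := core :\: [set x1; t].
have DE z : (z \in D) = [&& z != x1, z != t & z \in core] by rewrite !inE negb_or andbA.
have notcore y x : leaf_at G y x -> t != y.
  by move=> /leaf_at_core yc; apply: contraNneq yc => <-.
have ne x y : x \in core -> leaf_at G y x -> x != y.
  by move=> xc /leaf_at_core; apply: contraNneq => <-.
have [conn|apart] := boolP (connect (within G D) x2 x3).
  (* [x1] can replace [t] on paths avoiding [u], so [t] may be deleted. *)
  have detour u r : u != x1 -> u != t -> r \in core -> r != u -> r != t ->
      connect (within G (core :\: [set u; t])) x1 r.
    move=> ux1 ut rc ru rt; set A := core :\: _.
    have AE z : (z \in A) = [&& z != u, z != t & z \in core] by rewrite !inE negb_or andbA.
    pose phi z := if z == t then x1 else z.
    have x1r : connect (within G (core :\: [set u])) x1 r by apply: core_connected1; rewrite // eq_sym.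
    have x1A : x1 \in A by rewrite AE eq_sym ux1 eq_sym t1.
    suff : r \in [pred z | connect (within G A) x1 (phi z)] by rewrite inE /phi (negPf rt).
    apply: connect_ind x1r _; last by rewrite inE /phi eq_sym (negPf t1) connect0.
    move=> a b; rewrite !inE => x1a /and3P[aU bU ab].
    have /andP[au ac] : (a != u) && (a \in core) by move: aU; rewrite in_setD in_set1.
    have /andP[bu bc] : (b != u) && (b \in core) by move: bU; rewrite in_setD in_set1.
    have [<-|nab] := eqVneq (phi a) (phi b); first exact: x1a.
    apply: connect_trans x1a (connect1 _); move: nab; rewrite /within /phi.
    have [at_|at_] := eqVneq a t; have [bt|bt] := eqVneq b t.
    - by rewrite eqxx.
    - by rewrite eq_sym => bx1; rewrite x1A AE bu bt bc -twin // -at_.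
    - by move=> ax1; rewrite x1A AE au at_ ac adj_sym -twin // -bt adj_sym.
    by rewrite !AE au at_ ac bu bt bc ab.
  have coreR z : z \in core -> z != t -> z \in [set~ t] by rewrite in_setC1.
  have AR u : core :\: [set u; t] \subset [set~ t].
    by apply/subsetP => z; rewrite !inE negb_or -andbA => /and3P[_ -> _].
  have yR y x : leaf_at G y x -> y \in [set~ t] by move=> /notcore; rewrite in_setC1 eq_sym.
  case: (@not_linearizable_three _ G [set~ t] x1 y1 x2 y2 x3 y3); last exact: (critG.2 [::] t).
  - by split; apply: coreR; rewrite // eq_sym.
  - by split; [apply: yR l1 | apply: yR l2 | apply: yR l3].
  - by split.
  - by split; apply: ne.
  - apply: (pendant_separates _ (yR _ _ l1) (leaf_at_sees l1) (AR x1) _ conn).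
      by rewrite in_setC1 eq_sym.
    by rewrite !inE eqxx.
  - apply: (pendant_separates _ (yR _ _ l2) (leaf_at_sees l2) (AR x2)).
    + by rewrite in_setC1 eq_sym.
    + by rewrite !inE eqxx.
    by apply: detour; rewrite // eq_sym.
  apply: (pendant_separates _ (yR _ _ l3) (leaf_at_sees l3) (AR x3)).
  + by rewrite in_setC1 eq_sym.
  + by rewrite !inE eqxx.
  by apply: detour; rewrite // eq_sym.
have lcE (H : sgraph V) v x y :
  local_complement H v x y = H x y (+) [&& x != y, H v x & H v y] by rewrite /= /lc_adj !inE.
have ty y x : leaf_at G y x -> G t y = (t == x) by move=> y_x; rewrite adj_sym y_x.
have x1y y x : leaf_at G y x -> G x1 y = (x1 == x) by move=> y_x; rewrite adj_sym y_x.
have twinD z : z \in D -> G t z = G x1 z by rewrite DE => /and3P[? ? ?]; apply: twin.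
have [x1t|x1t] := boolP (G x1 t); last first.
  apply: (@twin_minor_not_linearizable _ G critG x1 y1 x2 y2 x3 y3 t
    (local_complement G t) leaves tc t_ne apart _ _ _ _ _ (critG.2 [:: t] t)).
  - by move=> z z' _ _; rewrite lcE.
  - by move=> z zD; rewrite lcE (adj_sym G t x1) (negPf x1t) !(andFb, andbF) addbF twinD.
  - by move=> z _; rewrite lcE (ty _ _ l2) (negPf t2) !(andFb, andbF) addbF l2.
  - by move=> z _; rewrite lcE (ty _ _ l3) (negPf t3) !(andFb, andbF) addbF l3.
  by left=> z _; rewrite lcE (ty _ _ l1) (negPf t1) !(andFb, andbF) addbF l1.
(* In [G1] the vertex [t] has lost its neighbours in [D] and sees [x1] and [y1], while [y1] has
   gained the neighbours of [x1] in [D]. Complementing at [t] then only removes the edge [x1 y1]. *)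
pose G1 := local_complement G x1.
have G1E x y : G1 x y = G x y (+) [&& x != y, G x1 x & G x1 y] by rewrite lcE.
have G1tD z : z \in D -> G1 t z = false.
  move=> zD; rewrite G1E twinD // x1t.
  by have -> : t != z; [move: zD; rewrite DE (eq_sym t z) => /and3P[] | rewrite addbb].
have G1tx1 : G1 t x1 by rewrite G1E adj_irr !(andFb, andbF) addbF adj_sym.
have G1ty1 : G1 t y1 by rewrite G1E (ty _ _ l1) (negPf t1) x1t (x1y _ _ l1) eqxx (notcore _ _ l1).
have G1ty y x : leaf_at G y x -> x1 != x -> t != x -> G1 t y = false.
  by move=> y_x x1x tx; rewrite G1E (ty _ _ y_x) (x1y _ _ y_x) (negPf x1x) (negPf tx) !(andFb, andbF).
have leaf_M y x : leaf_at G y x -> x1 != x -> t != x ->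
    sees_only (local_complement G1 t) [set~ t] y x.
  move=> y_x x1x tx z _; rewrite lcE (G1ty y x) // !(andFb, andbF) addbF G1E.
  by rewrite (x1y _ _ y_x) (negPf x1x) !(andFb, andbF) addbF y_x.
apply: (@twin_minor_not_linearizable _ G critG x1 y1 x2 y2 x3 y3 t
  (local_complement G1 t) leaves tc t_ne apart _ _ _ _ _ (critG.2 [:: x1; t] t)).
- by move=> z z' zD z'D; rewrite lcE (G1tD z) // !(andFb, andbF) addbF G1E !twinD.
- by move=> z zD; rewrite lcE (G1tD z zD) !(andFb, andbF) addbF G1E adj_irr !(andFb, andbF) addbF twinD.
- exact: leaf_M.
- exact: leaf_M.
right=> z; rewrite in_setC1 => zt; rewrite lcE G1ty1 G1E l1 (x1y _ _ l1) eqxx !andTb.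
have [zx1|zx1] := eqVneq z x1.
  by rewrite zx1 adj_irr andbF G1tx1 andbT eq_sym (ne x1 y1) // DE eqxx.
have [zc|zc] := boolP (z \in core).
  have zD : z \in D by rewrite DE zx1 zt.
  have -> : y1 != z by apply: contraTneq zc => <-; apply: leaf_at_core l1.
  by rewrite zD G1tD // twinD //= addbF.
rewrite DE (negPf zc) !andbF andFb.
case/or3P: (three_leaves_all critG leaves zc) => /eqP ->.
- by rewrite eqxx.
- by rewrite (G1ty _ _ l2) // (x1y _ _ l2) (negPf n12) !andbF.
by rewrite (G1ty _ _ l3) // (x1y _ _ l3) (negPf n13) !andbF.
Qed.

(** No edge passes over [x], and the core without [x] is connected, so it lies on one side of
    [x]. *)
Lemma core_first_or_last (S : {set V}) f x y : layout G S f -> core \subset S -> y \in S ->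
  x \in core -> leaf_at G y x ->
  {in core :\ x, forall z, f x < f z} \/ {in core :\ x, forall z, f z < f x}.
Proof.
move=> layf /subsetP coreS yS xc y_x.
have ne z : z \in core :\ x -> f z != f x.
  rewrite in_setD1 => /andP[zx zc]; apply: contraNneq zx.
  by move/(layf.1 _ _ (coreS z zc) (coreS x xc)) => ->.
have split_x := pendant_split layf yS (coreS x xc) (leaf_at_sees y_x).
have [/existsP[a /andP[aD fax]]|/existsPn noA] := boolP [exists a, (a \in core :\ x) && (f a < f x)];
  last first.
  by left=> z zD; have := noA z; rewrite zD -leqNgt leq_eqVlt eq_sym (negPf (ne z zD)).
right=> b bD; apply/negPn/negP => fbx.
move: (aD) (bD); rewrite !in_setD1 => /andP[ax ac] /andP[bx bc].
have [c [d [/and3P[cD dD cd] cA dA _ _]]] := @connect_cross _ _ [pred z | f z < f x] _ _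
  (core_connected1 critG ac bc ax bx) fax fbx.
move: (cD) (dD); rewrite -!/(core :\ x) => cD' dD'.
have fxd : f x < f d by move: dA; rewrite inE -leqNgt leq_eqVlt eq_sym (negPf (ne d dD')).
move: cD' dD'; rewrite !in_setD1 => /andP[_ cc] /andP[_ dc].
by have := split_x c d (coreS c cc) (coreS d dc) cA fxd; rewrite cd.
Qed.

(** Across the threshold after [x] and [t], the first two core vertices, their rows are dependent.
    Both rows are nonzero by 2-connectivity of the core, hence equal over GF(2). *)
Lemma next_is_twin (S : {set V}) f x : layout G S f -> core \subset S -> 2 < #|core| ->
  x \in core -> {in core :\ x, forall z, f x < f z} ->
  exists t, [/\ t \in core, t != x, {in core :\ x, forall z, f t <= f z} &
    forall z, z \in core -> z != x -> z != t -> G t z = G x z].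
Proof.
move=> layf /subsetP coreS core3 xc first_x.
have core2 : 1 < #|core :\ x| by have := cardsD1 x core; rewrite xc; lia.
have /card_gt0P[z0 z0D] : 0 < #|core :\ x| by apply: ltnW.
have [t tD t_min] : exists2 t, t \in core :\ x & {in core :\ x, forall z, f t <= f z}.
  by case: (@arg_minnP _ z0 [pred z | z \in core :\ x] f z0D) => t tD t_min; exists t.
move: (tD); rewrite in_setD1 => /andP[tx tc].
exists t; split=> //.
have lt_t z : z \in core -> z != x -> z != t -> f t < f z.
  move=> zc zx zt; rewrite ltn_neqAle t_min ?in_setD1 ?zx // andbT.
  by apply: contraNneq zt => /(layf.1 _ _ (coreS t tc) (coreS z zc)) ->.
have lt_x z : z \in core -> z != x -> f x < f z by move=> zc zx; apply: first_x; rewrite in_setD1 zx.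
have [w [wc wx wt]] : exists w, [/\ w \in core, w != x & w != t].
  have /card_gt0P[w] : 0 < #|(core :\ x) :\ t| by have := cardsD1 t (core :\ x); rewrite tD; lia.
  by rewrite !in_setD1 => /and3P[wt wx wc]; exists w.
have has_nbr a b : a \in core -> w != a -> w != b -> a != b ->
    exists c, [/\ c \in core, c != b, c != a & G a c].
  move=> ac wa wb ab.
  have [c [d [/and3P[_ dD cd] /eqP ca dA _ _]]] := @connect_cross _ _ (pred1 a) _ _
    (core_connected1 critG ac wc ab wb) (eqxx a) wa.
  move: dD; rewrite in_setD in_set1 => /andP[db dc].
  by exists d; rewrite -ca; split=> //; rewrite ca.
have [u [uc ut ux xu]] := has_nbr x t xc wx wt (contra_neq (@esym _ _ _) tx).
have [v [vc vx vt tv]] := has_nbr t x tc wt wx tx.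
move=> c cc cx ct.
have minor d : d \in core -> d != x -> d != t -> G x c && G t d = G x d && G t c.
  by move=> dc dx dt; apply: layf.2; rewrite ?coreS ?lt_x ?lt_t.
by have := minor u uc ux ut; have := minor v vc vx vt;
  rewrite xu tv; case: (G x c) (G t c) (G x v) (G t u) => [] [] [] [].
Qed.

(** Up to reversal, a layout without [y3] starts the core with [x1] and ends it with [x2]. Given a
    further core vertex [w], the twins next to the two ends cannot both be [x3], as [w] lies between
    them; the one that is not contradicts [no_core_twin]. *)
Lemma three_leaves_core x1 y1 x2 y2 x3 y3 : three_leaves G x1 y1 x2 y2 x3 y3 ->
  core = [set x1; x2; x3].
Proof.
move=> leaves; have [[l1 l2 l3] [x1c x2c x3c] [n12 n13 n23]] := leaves.
apply/eqP; rewrite eqEsubset; apply/andP; split; last first.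
  by apply/subsetP => z; rewrite !in_setU !in_set1 -orbA => /or3P[]/eqP->.
apply/subsetP => w wc; apply: contraT; rewrite !inE !negb_or -andbA => /and3P[w1 w2 w3].
have core3 : 2 < #|core|.
  have /card_uniqP card3 : uniq [:: x1; x2; x3] by rewrite /= !inE negb_or n12 n13 n23.
  apply: leq_trans (_ : #|[:: x1; x2; x3]| <= _); first by rewrite card3.
  by apply/subset_leq_card/subsetP => z; rewrite !in_cons in_nil orbF => /or3P[]/eqP->.
have [f layf] := critG.2 [::] y3.
have y3c := leaf_at_core l3.
have coreS : core \subset [set~ y3].
  by apply/subsetP => z zc; rewrite in_setC1; apply: contraNneq y3c => <-.
have yS y x : leaf_at G y x -> x != x3 -> y \in [set~ y3].
  by move=> y_x; rewrite in_setC1; apply: contraNneq => y_y3;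
  have := y_x x3; rewrite y_y3 l3 eqxx eq_sym => <-.
have y1S := yS _ _ l1 n13; have y2S := yS _ _ l2 n23.
wlog first1 : f layf / {in core :\ x1, forall z, f x1 < f z}.
  move=> hwlog; case: (core_first_or_last layf coreS y1S x1c l1); first exact: hwlog.
  have [g layg gE] := layout_rev layf => last1; apply: (hwlog g layg) => z zD.
  by rewrite gE last1.
have last2 : {in core :\ x2, forall z, f z < f x2}.
  case: (core_first_or_last layf coreS y2S x2c l2) => // first2.
  have := first1 x2; have := first2 x1; rewrite !in_setD1 n12 eq_sym n12 x1c x2c.
  by move=> /(_ isT) lt21 /(_ isT) lt12; have := ltn_trans lt12 lt21; rewrite ltnn.
have [t [tc tx1 t_min twin1]] := next_is_twin layf coreS core3 x1c first1.
have [g layg gE] := layout_rev layf.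
have first2 : {in core :\ x2, forall z, g x2 < g z} by move=> z zD; rewrite gE last2.
have [t' [t'c t'x2 t'_max twin2]] := next_is_twin layg coreS core3 x2c first2.
have wD1 : w \in core :\ x1 by rewrite in_setD1 w1.
have wD2 : w \in core :\ x2 by rewrite in_setD1 w2.
have tw := t_min w wD1; have t'w := t'_max w wD2.
have tx2 : t != x2 by apply: contraTneq tw => ->; rewrite -ltnNge last2.
have t'x1 : t' != x1 by apply: contraTneq t'w => ->; rewrite -ltnNge gE first1.
have [tx3|tx3] := eqVneq t x3; last first.
  by case: (no_core_twin leaves tc _ twin1).
have [t'x3|t'x3] := eqVneq t' x3.
  move: t'w; rewrite leqNgt gE t'x3 -leqNgt; rewrite tx3 in tw => wx3.
  case/eqP: w3; apply: layf.1; rewrite ?(subsetP coreS) //.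
  by apply/eqP; rewrite eqn_leq wx3 tw.
have leaves' : three_leaves G x2 y2 x1 y1 x3 y3 by split; split; rewrite // eq_sym.
by case: (no_core_twin leaves' t'c _ twin2).
Qed.

End Twins.

(** * Structure of obstructions *)

Lemma connect_lift (U V : finType) (i : U -> V) (e : rel U) (e' : rel V) x y :
  injective i -> (forall u v, e' (i u) v -> exists2 w, v = i w & e u w) ->
  connect e' (i x) (i y) -> connect e x y.
Proof.
move=> i_inj lift xy.
have : i y \in [pred v | [exists u, (i u == v) && connect e x u]].
  apply: connect_ind xy _; last by apply/existsP; exists x; rewrite eqxx connect0.
  move=> a b /existsP[u /andP[/eqP <- xu]] /lift[w -> uw].
  by apply/existsP; exists w; rewrite eqxx (connect_trans xu (connect1 uw)).
by case/existsP => u /andP[/eqP/i_inj->].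
Qed.

Section Induced.
Variables (V : finType) (G : sgraph V) (S : {set V}).

Definition induced_adj : rel {x : V | x \in S} := relpre val G.

Lemma induced_adj_sym : symmetric induced_adj.
Proof. by move=> x y; apply: adj_sym. Qed.

Lemma induced_adj_irr : irreflexive induced_adj.
Proof. by move=> x; apply: adj_irr. Qed.

Definition induced : sgraph {x : V | x \in S} := SGraph induced_adj_sym induced_adj_irr.

End Induced.

Section Structure.
Variables (V : finType) (G : sgraph V).
Hypothesis critG : critical G.

Lemma leaf_of_pendant p : pendant G p -> exists v, leaf_at G p v.
Proof.
move=> pp; have /card_gt0P[v] := critical_degree critG p; rewrite inE => pv.
by exists v; apply: leaf_at_pendant.
Qed.

(** Two adjacent pendant vertices would form a component, hence by connectivity the whole graph,
    which has more than two vertices. *)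
Lemma pendant_core p v : leaf_at G p v -> v \in core G.
Proof.
move=> p_v; rewrite inE; apply/negP => /leaf_of_pendant[w v_w].
have vp : G v p by rewrite adj_sym p_v.
have {w v_w} v_p z : G v z = (z == p) by rewrite v_w; move: vp; rewrite v_w => /eqP->.
have closed z : z \in [:: p; v].
  apply: connect_ind (critical_connect critG p z) _; last exact: mem_head.
  by move=> a b; rewrite !inE => /orP[]/eqP->; rewrite ?p_v ?v_p => ->; rewrite ?orbT.
have := critical_card critG; rewrite ltnNge; case/negP.
rewrite cardE; apply: leq_trans (_ : size [:: p; v] <= 2) => //.
by apply: uniq_leq_size (enum_uniq _) _ => z _; apply: closed.
Qed.

(** A core vertex has two neighbours; were it alone in the core, both would be pendant at it. *)
Lemma core_card : 1 < #|core G|.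
Proof.
have /card_gt0P[x _] : 0 < #|V| by apply: leq_trans (critical_card critG).
have [s sc] : exists s, s \in core G.
  have [/leaf_of_pendant[v x_v]|px] := boolP (pendant G x); first by exists v; apply: pendant_core x_v.
  by exists x; rewrite inE.
have [z sz _] := core_nbr critG s sc; have [u su uz] := core_nbr critG z sc.
rewrite ltnNge; apply: contraNN uz => core1.
have leaf y : G s y -> leaf_at G y s.
  move=> sy; apply: leaf_at_pendant; last by rewrite adj_sym.
  apply: contraTT sy => py; have yc : y \in core G by rewrite inE.
  by rewrite (card_le1_eqP core1 y s yc sc) adj_irr.
by rewrite (leaf_unique critG (leaf u su) (leaf z sz)).
Qed.

(** Stated for an embedding [i] onto the core, so that it serves both the subgraph induced by the
    core and, in the absence of pendant vertices, [G] itself. *)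
Lemma two_connected_core (U : finType) (H : sgraph U) (i : U -> V) :
  injective i -> (forall v, reflect (exists u, v = i u) (v \in core G)) ->
  (forall x y, H x y = G (i x) (i y)) -> two_connected H.
Proof.
move=> i_inj imP HE.
have codom_i : core G = [set i u | u : U].
  apply/setP => v; apply/imP/imsetP => [[u ->]|[u _ ->]]; by exists u.
have cardU : #|U| = #|core G| by rewrite codom_i card_imset.
have icore u : i u \in core G by apply/imP; exists u.
split=> [|T T2]; first by rewrite cardU core_card.
have iT u : (i u \in [set i u | u in T]) = (u \in T) by rewrite mem_imset.
split=> [|x y].
  have /card_gt0P[u] : 0 < #|~: T| by have := cardsC T; have := core_card; rewrite -cardU; lia.
  by rewrite inE => uT; apply/card_gt0P; exists (exist (fun u => u \notin T) u uT).
have inR (z : {u | u \notin T}) : i (val z) \in core G :\: [set i u | u in T].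
  by rewrite inE iT icore andbT; exact: (valP z).
have T1 : #|[set i u | u in T]| <= 1 by rewrite card_imset.
apply: (@connect_lift _ _ (fun z : {u | u \notin T} => i (val z)) _ _ x y _ _
  (core_connected critG T1 (inR x) (inR y))); first by move=> u v /i_inj/val_inj.
move=> u v /and3P[_ + uv]; rewrite in_setD => /andP[vT /imP[w vE]].
have wT : w \notin T by rewrite -iT -vE.
by exists (exist (fun u => u \notin T) w wT) => //=; rewrite /del_adj /= HE -vE.
Qed.

Lemma net_of_core x1 y1 x2 y2 x3 y3 : three_leaves G x1 y1 x2 y2 x3 y3 -> isomorphic G net.
Proof.
move=> leaves; have [[l1 l2 l3] [x1c x2c x3c] [n12 n13 n23]] := leaves.
have coreE := three_leaves_core critG leaves.
pose X (k : 'I_3) := nth x1 [:: x1; x2; x3] k.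
pose Y (k : 'I_3) := nth y1 [:: y1; y2; y3] k.
have leafXY k : leaf_at G (Y k) (X k) by case: k => [[|[|[|//]]] ?].
have Xcore k : X k \in core G by case: k => [[|[|[|//]]] ?].
have X_inj : injective X.
  have uX : uniq [:: x1; x2; x3] by rewrite /= !inE negb_or n12 n13 n23.
  by move=> k l /eqP; rewrite nth_uniq // => /eqP/val_inj.
have X_surj v : v \in core G -> exists k, X k = v.
  rewrite coreE !in_setU !in_set1 -orbA => /or3P[]/eqP->.
  - by exists (inord 0); rewrite /X inordK.
  - by exists (inord 1); rewrite /X inordK.
  by exists (inord 2); rewrite /X inordK.
have Y_surj v : v \notin core G -> exists k, Y k = v.
  case/(three_leaves_all critG leaves)/or3P => /eqP->.
  - by exists (inord 0); rewrite /Y inordK.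
  - by exists (inord 1); rewrite /Y inordK.
  by exists (inord 2); rewrite /Y inordK.
have Ycore k : Y k \notin core G by apply: leaf_at_core (leafXY k).
have XY k l : X k != Y l by apply: contraTneq (Xcore k) => ->.
(* The core without the third vertex [X u] is connected and consists of [X k] and [X l] only. *)
have XX k l : k != l -> G (X k) (X l).
  move=> kl; have [u uk ul] : exists2 u : 'I_3, u != k & u != l.
    have /card_gt0P[u] : 0 < #|~: [set k; l]|.
      by have := cardsC [set k; l]; rewrite cards2 kl card_ord; case: #|_|.
    by rewrite !inE negb_or => /andP[uk ul]; exists u.
  have nX a b : a != b -> X a != X b by rewrite (inj_eq X_inj).
  have ku := nX k u; have lu := nX l u; rewrite ![_ == u]eq_sym uk ul in ku lu.
  have lX : X l \notin pred1 (X k) by rewrite inE nX // eq_sym.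
  have [a [b [/and3P[_ bD ab] /eqP ax bx _ _]]] := @connect_cross _ _ (pred1 (X k)) _ _
    (core_connected1 critG (Xcore k) (Xcore l) (ku isT) (lu isT)) (eqxx (X k)) lX.
  move: bD; rewrite in_setD in_set1 => /andP[bu /X_surj[m bE]].
  suff -> : l = m by rewrite bE -ax.
  have mu : m != u by apply: contraNneq bu => <-; rewrite bE.
  have mk : m != k by apply: contraNneq bx => <-; rewrite bE inE.
  apply: val_inj; move: kl uk ul mu mk; rewrite -!val_eqE /=.
  by have := ltn_ord k; have := ltn_ord l; have := ltn_ord u; have := ltn_ord m; lia.
pose g (a : 'I_3 + 'I_3) := match a with inl k => X k | inr k => Y k end.
have g_bij : bijective g.
  apply: inj_surj_bij => [[k|k] [l|l] /= eq_g|v].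
  - by rewrite (X_inj k l).
  - by have := XY k l; rewrite eq_g eqxx.
  - by have := XY l k; rewrite eq_g eqxx.
  - by have := leafXY k (X l); rewrite eq_g (leafXY l) eqxx => /esym/eqP/X_inj->.
  have [/X_surj[k <-]|/Y_surj[k <-]] := boolP (v \in core G); first by exists (inl k).
  by exists (inr k).
have gE a b : G (g a) (g b) = net a b.
  case: a b => [k|k] [l|l] /=.
  - by have [->|/XX] := eqVneq k l; rewrite ?adj_irr.
  - by rewrite adj_sym leafXY (inj_eq X_inj).
  - by rewrite leafXY (inj_eq X_inj) eq_sym.
  by rewrite leafXY eq_sym (negPf (XY _ _)).
have [f gK fK] := g_bij.
by exists f; [exists g | move=> x y; rewrite -gE !fK].
Qed.

End Structure.

Theorem theorem19 (V : finType) (G : sgraph V)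
  (hG : obstruction linear_rankwidth_le1 G) :
  [\/ isomorphic G net,
      two_connected G,
      exists (S : {set V}) (G0 : sgraph {x : V | x \in S}) (u : V),
        [/\ subgraph G0 G, two_connected G0, S :|: [set u] = [set: V]
          & pendant G u]
    | exists (S : {set V}) (G0 : sgraph {x : V | x \in S}) (u v : V),
        [/\ subgraph G0 G /\ two_connected G0,
            u != v,
            S :|: [set u; v] = [set: V],
            pendant G u /\ pendant G v
          & nbr G u :&: nbr G v = set0]].
Proof.
have critG := critical_obstruction hG.
have leafP := leaf_of_pendant critG.
have tc_core : two_connected (induced G (core G)).
  apply: (two_connected_core critG val_inj) => // v.
  by apply: (iffP idP) => [vc|[u ->]]; [exists (exist _ v vc) | apply: valP].
have sub_core : subgraph (induced G (core G)) G by [].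
have pE v : pendant G v = (v \notin core G) by rewrite inE negbK.
(* The cases are one, two, no, and finally at least three pendant vertices. *)
have [/cards1P[p pendP]|] := boolP (#|~: core G| == 1).
  constructor 3; exists (core G), (induced G (core G)), p.
  by rewrite -pendP setUCr pE -in_setC pendP set11.
have [/cards2P|] := boolP (#|~: core G| == 2).
  case=> p [q [npq pendP]].
  have [pp pq] : pendant G p /\ pendant G q by rewrite !pE -!in_setC pendP set21 set22.
  constructor 4; exists (core G), (induced G (core G)), p, q.
  split=> //; first by rewrite -pendP setUCr.
  have [v p_v] := leafP p pp; have [w q_w] := leafP q pq.
  apply/setP => z; rewrite !inE p_v q_w; apply/negP => /andP[/eqP-> /eqP vw].
  by case/eqP: npq; apply: (leaf_unique critG p_v); rewrite vw.
have [/eqP|/card_gt0P[y1 y1P]] := posnP #|~: core G|.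
  rewrite cards_eq0 => /eqP pend0 _ _; constructor 2.
  apply: (two_connected_core critG (i := id)) => // v; apply: (iffP idP) => [_|_]; first by exists v.
  by rewrite -[core G]setCK pend0 setC0 inE.
move=> n1 n2; have := cardsD1 y1 (~: core G); rewrite y1P => card_y1.
have /card_gt0P[y2 y2P] : 0 < #|~: core G :\ y1| by lia.
have := cardsD1 y2 (~: core G :\ y1); rewrite y2P => card_y2.
have /card_gt0P[y3 y3P] : 0 < #|~: core G :\ y1 :\ y2| by lia.
move: y1P y2P y3P; rewrite !inE !negbK => p1 /andP[n21 p2] /and3P[n32 n31 p3].
have [x1 l1] := leafP y1 p1; have [x2 l2] := leafP y2 p2; have [x3 l3] := leafP y3 p3.
have ne p q v w : leaf_at G p v -> leaf_at G q w -> q != p -> v != w.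
  move=> p_v q_w; apply: contraNneq => vw; apply/eqP.
  by apply: (leaf_unique critG q_w); rewrite -vw.
constructor 1; apply: (net_of_core critG
  (x1 := x1) (y1 := y1) (x2 := x2) (y2 := y2) (x3 := x3) (y3 := y3)).
split; first by split.
  by split; [apply: pendant_core l1 | apply: pendant_core l2 | apply: pendant_core l3].
by split; [apply: ne l1 l2 n21 | apply: ne l1 l3 n31 | apply: ne l2 l3 n32].
Qed.
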